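(* Let $G=C_{n_1}\cup C_{n_2}\cup \ldots \cup C_{n_k}$ ($k\ge 1$, each $n_i\ge 3$) be a vertex-disjoint union of $k$ cycles. Then the cycles $C_3$, $C_4$ and the graph $2C_3$ are not embeddable; the graphs $C_5$, $C_6$, $C_3 \cup C_4$, $C_3 \cup C_5$, $3C_3$ and $4C_3$ are uniquely embeddable; and every other such graph $G$ has at least two distinct embeddings.
   Context: All graphs are finite, simple (no loops or multiple edges). $G_1\cup G_2$ denotes the vertex-disjoint union, and $mH$ denotes the union of $m$ disjoint copies of $H$; $C_n$ is the cycle on $n$ vertices. An embedding (or packing) of a graph $G=(V,E)$ is a permutation $\sigma$ of $V$ such that whenever $xy\in E$, $\sigma(x)\sigma(y)\notin E$; $G$ is embeddable if it has an embedding. For an embedding $\sigma$, $\sigma(G)$ is the graph on $V$ with edge set $\{\sigma(x)\sigma(y): xy\in E\}$, and $G\oplus\sigma(G)$ is the graph on $V$ with edge set $E\cup E(\sigma(G))$ (a disjoint union of edge sets). Two embeddings $\sigma_1,\sigma_2$ are distinct if $G\oplus\sigma_1(G)$ and $G\oplus\sigma_2(G)$ are non-isomorphic. $G$ is uniquely embeddable if it is embeddable and all graphs $G\oplus\sigma(G)$, over all embeddings $\sigma$, are isomorphic. *)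

(* Defs.v *)
From mathcomp Require Import all_boot all_order all_fingroup.

Set Implicit Arguments.
Unset Strict Implicit.
Unset Printing Implicit Defensive.

Record sgraph : Type := SGraph {
  vertex :> finType;
  adj : rel vertex;
  adj_sym : symmetric adj;
  adj_irr : irreflexive adj
}.

Definition isomorphic (G H : sgraph) : Prop :=
  exists2 f : G -> H, bijective f & forall x y : G, adj (f x) (f y) = adj x y.

(* [ordS] is the successor modulo n.  The conjunct [x != y] only matters for
   n = 1, where it removes the loop; for n >= 3 this is the cycle. *)
Definition cycle_adj (n : nat) : rel 'I_n :=
  fun x y => (x != y) && ((ordS x == y) || (ordS y == x)).

Lemma cycle_adj_sym n : symmetric (@cycle_adj n).
Proof. by move=> x y; rewrite /cycle_adj eq_sym orbC. Qed.

Lemma cycle_adj_irr n : irreflexive (@cycle_adj n).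
Proof. by move=> x; rewrite /cycle_adj eqxx. Qed.

Definition cycle_graph (n : nat) : sgraph :=
  SGraph (@cycle_adj_sym n) (@cycle_adj_irr n).

Definition empty_graph : sgraph :=
  @SGraph void (fun _ _ => false) (fun _ _ => erefl) (fun _ => erefl).

Definition disjoint_union_adj (G H : sgraph) : rel (G + H)%type :=
  fun x y => match x, y with
             | inl a, inl b => adj a b
             | inr a, inr b => adj a b
             | _, _ => false
             end.

Lemma disjoint_union_adj_sym G H : symmetric (@disjoint_union_adj G H).
Proof. by case=> a [b|b] //=; apply: adj_sym. Qed.

Lemma disjoint_union_adj_irr G H : irreflexive (@disjoint_union_adj G H).
Proof. by case=> a /=; apply: adj_irr. Qed.

Definition disjoint_union (G H : sgraph) : sgraph :=
  SGraph (@disjoint_union_adj_sym G H) (@disjoint_union_adj_irr G H).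

Definition copies (m : nat) (H : sgraph) : sgraph :=
  iter m (disjoint_union H) empty_graph.

Definition cycles (ns : seq nat) : sgraph :=
  foldr (fun n G => disjoint_union (cycle_graph n) G) empty_graph ns.

Definition union_of_cycles (G : sgraph) : Prop :=
  exists ns : seq nat,
    [/\ 0 < size ns, all (fun n => 3 <= n) ns & isomorphic G (cycles ns)].

Definition embedding (G : sgraph) (s : {perm G}) : Prop :=
  forall x y : G, adj x y -> ~~ adj (s x) (s y).

Definition embeddable (G : sgraph) : Prop :=
  exists s : {perm G}, embedding s.

(* Adjacency in s(G): the pair {x, y} is of the form {s u, s v} with uv an edge
   of G exactly when u = s^-1 x and v = s^-1 y are adjacent. *)
Definition image_adj (G : sgraph) (s : {perm G}) : rel G :=
  fun x y => adj ((s^-1)%g x) ((s^-1)%g y).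

Definition oplus_adj (G : sgraph) (s : {perm G}) : rel G :=
  fun x y => adj x y || image_adj s x y.

Lemma oplus_adj_sym (G : sgraph) (s : {perm G}) : symmetric (oplus_adj s).
Proof.
by move=> x y; rewrite /oplus_adj /image_adj adj_sym; congr (_ || _); apply: adj_sym.
Qed.

Lemma oplus_adj_irr (G : sgraph) (s : {perm G}) : irreflexive (oplus_adj s).
Proof. by move=> x; rewrite /oplus_adj /image_adj !adj_irr. Qed.

Definition oplus (G : sgraph) (s : {perm G}) : sgraph :=
  SGraph (oplus_adj_sym s) (oplus_adj_irr s).

Definition distinct_embeddings (G : sgraph) (s1 s2 : {perm G}) : Prop :=
  [/\ embedding s1, embedding s2 & ~ isomorphic (oplus s1) (oplus s2)].

Definition uniquely_embeddable (G : sgraph) : Prop :=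
  embeddable G /\
  forall s1 s2 : {perm G}, embedding s1 -> embedding s2 ->
    isomorphic (oplus s1) (oplus s2).

Definition not_embeddable_list : seq sgraph :=
  [:: cycle_graph 3; cycle_graph 4; copies 2 (cycle_graph 3)].

Definition uniquely_embeddable_list : seq sgraph :=
  [:: cycle_graph 5; cycle_graph 6;
      disjoint_union (cycle_graph 3) (cycle_graph 4);
      disjoint_union (cycle_graph 3) (cycle_graph 5);
      copies 3 (cycle_graph 3); copies 4 (cycle_graph 3)].

(* Main.v *)
Require Import Defs.
From mathcomp Require Import all_boot all_order all_fingroup.
From mathcomp Require Import zify.
From Stdlib Require List.

Set Implicit Arguments.
Unset Strict Implicit.
Unset Printing Implicit Defensive.

(* Think of an embedding as a decomposition of a 4-regular graph into a red and a
   blue copy of G.  Pinching, i.e. subdividing a red and a disjoint blue edge and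
   identifying the two new vertices, lengthens one red and one blue cycle.  It
   preserves connectedness, it never creates a K4, and it keeps a K4 that does not
   contain the pinched edges.

   From C_5, C_3 + C_4 and k C_3 (k >= 3), pinching gives a connected packing of
   every embeddable G.  If G is a disjoint union of two embeddable graphs, it also
   has a disconnected packing.  The only other graphs are C_n, C_3 + C_n, C_4 + C_n,
   2 C_3 + C_n, C_3 + 2 C_4, 3 C_4, 3 C_3 + C_4 and 5 C_3.  They have, up to
   finitely many cases, a packing with a K4 (from small ones by pinching) and one
   without; in the remaining cases C_7, C_3 + C_6, 2 C_3 + C_5 and 5 C_3, the
   triangular prism plays the role of K4.

   In a packing of 3 C_3 or 4 C_3 a vertex is determined by its red and its blue
   triangle, so the union is the 3 x 3 rook's graph, respectively the 4 x 4 rook's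
   graph without a transversal.  The other small graphs are settled by exhaustive
   search. *)

(** * Packings given by lists of labelled cycles, and pinching *)

Definition cyc_edges (c : seq nat) : seq (nat * nat) := zip c (rot 1 c).
Definition edges (cs : seq (seq nat)) := flatten [seq cyc_edges c | c <- cs].
Definition ladj cs : rel nat :=
  fun x y => ((x, y) \in edges cs) || ((y, x) \in edges cs).
Definition uadj rs bs : rel nat := fun x y => ladj rs x y || ladj bs x y.

(* [rs] and [bs] list the red and the blue cycles of a packing of cycles of lengths
   [ns], each cycle being given by the cyclic sequence of its vertex labels. *)
Definition packs ns rs bs :=
  [&& all (leq 3) ns, perm_eq (shape rs) ns, perm_eq (shape bs) ns,
      uniq (flatten rs), perm_eq (flatten rs) (flatten bs)
    & allrel (fun x y => ~~ (ladj rs x y && ladj bs x y))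
             (flatten rs) (flatten rs)].

Lemma mem_zip (x y : nat) s t : (x, y) \in zip s t -> (x \in s) && (y \in t).
Proof.
elim: s t => [|a s IH] [|b t] //=; rewrite !inE xpair_eqE.
by case/orP=> [/andP [-> ->] //|/IH /andP [-> ->]]; rewrite !orbT.
Qed.

Lemma zip_rot (S T : Type) k (s : seq S) (t : seq T) :
  size s = size t -> zip (rot k s) (rot k t) = rot k (zip s t).
Proof.
move=> E; rewrite /rot zip_cat ?size_drop ?E //.
congr (_ ++ _).
- by elim: k s t E => [|k IH] [|a s] [|b t] //= [E]; rewrite ?drop0 // IH.
- by elim: k s t E => [|k IH] [|a s] [|b t] //= [E]; rewrite ?take0 // IH.
Qed.

Lemma cyc_edges_rot k c : cyc_edges (rot k c) = rot k (cyc_edges c).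
Proof. by rewrite /cyc_edges rot_rot zip_rot // size_rot. Qed.

Lemma cyc_edges_cons y t :
  cyc_edges (y :: t) = rcons (zip (belast y t) t) (last y t, y).
Proof. by rewrite /cyc_edges rot1_cons lastI zip_rcons // size_belast. Qed.

Lemma cyc_edges_cons2 y t v : cyc_edges (y :: rcons t v) =
  rcons (rcons (zip (belast y t) t) (last y t, v)) (v, y).
Proof.
by rewrite cyc_edges_cons belast_rcons last_rcons lastI zip_rcons // size_belast.
Qed.

Lemma mem_cyc_edges x y c :
  (x, y) \in cyc_edges c -> (x \in c) && (y \in c).
Proof.
by case/mem_zip/andP=> ->; rewrite mem_rot.
Qed.

Lemma mem_edges x y cs :
  (x, y) \in edges cs -> (x \in flatten cs) && (y \in flatten cs).
Proof.
case/flattenP=> _ /mapP [c cin ->] /mem_cyc_edges /andP [hx hy].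
by apply/andP; split; apply/flattenP; exists c.
Qed.

Lemma ladj_sym cs : symmetric (ladj cs).
Proof. by move=> x y; rewrite /ladj orbC. Qed.

Lemma mem_ladj x y cs :
  ladj cs x y -> (x \in flatten cs) && (y \in flatten cs).
Proof. by case/orP=> /mem_edges // /andP [-> ->]. Qed.

(** Puts a given edge in closing position, so that subdividing it amounts to appending the new
    vertex at the end of the list. *)
Lemma cyc_edge_rot x y c : (x, y) \in cyc_edges c ->
  exists k t, rot k c = y :: t /\ last y t = x.
Proof.
move=> exy; case: (rot_to exy) => k E'; rewrite -cyc_edges_rot.
have [k' Hr] : exists k', rot 1 (rot k c) = rot k' c.
  have c1 : 0 < size c by case: c exy.
  by rewrite (rot_minn k) (rot_add_mod (geq_minr _ _) c1); eexists.
case: (rot k c) Hr => [//|x' s] Hr.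
rewrite /cyc_edges rot1_cons.
case Es : (rcons s x') => [|y' t]; first by case: s Es {Hr}.
case=> Ex Ey _; subst x' y'.
have Et : last y t = x by have := last_rcons y s x; rewrite Es.
move: Hr; rewrite rot1_cons Es => Hr.
by exists k', t.
Qed.

Definition same_pair (a b x y : nat) :=
  ((a, b) == (x, y)) || ((a, b) == (y, x)).

Lemma edges_perm cs cs' : perm_eq cs cs' -> edges cs =i edges cs'.
Proof. by move=> P; apply/perm_mem/perm_flatten/perm_map. Qed.

Lemma ladj_perm cs cs' : edges cs =i edges cs' -> ladj cs =2 ladj cs'.
Proof. by move=> P x y; rewrite /ladj !P. Qed.

Lemma expose cs c k : c \in cs ->
  [/\ perm_eq (shape cs) (shape (rot k c :: rem c cs)),
      perm_eq (flatten cs) (flatten (rot k c :: rem c cs))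
    & edges cs =i edges (rot k c :: rem c cs)].
Proof.
move=> cin; have P := perm_to_rem cin; split.
- by rewrite (perm_trans (perm_map size P)) //= size_rot.
- rewrite (perm_trans (perm_flatten P)) //= perm_cat2r perm_sym perm_rot //.
- move=> z; rewrite (edges_perm P) /edges /= !mem_cat cyc_edges_rot mem_rot //.
Qed.

(** A cycle on two vertices would traverse the same pair twice; from three vertices on, the path
    from [y] through [t] does not contain its closing edge. *)
Lemma closing_edge (y : nat) (t : seq nat) :
  uniq (y :: t) -> 1 < size t -> (y, last y t) \notin zip (belast y t) t.
Proof.
case: t => [|t0 [|t1 t]] // /andP [yt /andP [ut _]] _.
rewrite /= inE xpair_eqE eqxx /=; apply/norP; split.
  by apply: contraNneq ut => <-; exact: mem_last.
by apply: contra yt => /(@mem_zip _ _ (t0 :: _) (t1 :: _)) /andP [h _]; apply: mem_belast.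
Qed.

(** Subdivision of the edge [xy] by [v]: after a rotation [xy] closes the cycle, and appending [v]
    replaces it by [xv] and [vy]. *)
Lemma stretch cs c x y v ns :
  uniq (flatten cs) -> c \in cs -> 2 < size c -> (x, y) \in cyc_edges c ->
  v \notin flatten cs -> perm_eq (shape cs) (size c :: ns) ->
  exists cs', [/\ perm_eq (flatten cs') (v :: flatten cs),
    perm_eq (shape cs') ((size c).+1 :: ns)
  & forall a b, ladj cs' a b =
      if a == v then b \in [:: x; y]
      else if b == v then a \in [:: x; y]
      else ladj cs a b && ~~ same_pair a b x y].
Proof.
move=> U cin sc exy; have [k [t [Er El]]] := cyc_edge_rot exy.
have [] := expose k cin; rewrite Er; set cs1 := rem c cs => Ps Pf Pe vn Pn.
have St : size c = (size t).+1 by rewrite -(size_rot k) Er.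
exists ((y :: rcons t v) :: cs1); split.
- apply/seq.permP=> p; rewrite -cats1 /= (seq.permP Pf) /= !count_cat /=; lia.
- rewrite /= size_rcons -St perm_cons.
  by move: Pn; rewrite (permPl Ps) /= -St perm_cons.
move=> a b; rewrite (ladj_perm Pe).
have U1 : uniq (flatten ((y :: t) :: cs1)) by rewrite -(perm_uniq Pf).
have V1 : v \notin flatten ((y :: t) :: cs1) by rewrite -(perm_mem Pf).
rewrite /ladj /edges /= -/(edges cs1) cyc_edges_cons2 cyc_edges_cons El.
rewrite !(mem_cat, mem_rcons, inE).
move: U1; rewrite /= cat_uniq mem_cat negb_or => /andP [/andP [yt yf] /and3P [ut /hasPn tf _]].
move: V1; rewrite /= inE mem_cat !negb_or => /and3P [vy vt vf].
have t1 : 1 < size t by rewrite -ltnS -St.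
have xt : x \in t by rewrite -El; case: (t) t1 => [|? ?] // _; exact: mem_last.
have F1 p q : (p, q) \in edges cs1 -> [&& p != v, q != v, p != y, q != y & p != x].
  case/mem_edges/andP=> hp hq; apply/and5P; split;
    do ?[by apply: contraTneq hp => ->; rewrite ?vf ?yf
        | by apply: contraTneq hq => ->; rewrite ?vf ?yf].
  by apply: contraTneq hp => ->; apply: contraL xt => /tf.
have Z1 p q : (p, q) \in zip (belast y t) t ->
    [&& p != v, q != v, q != y & ~~ ((p == y) && (q == x))].
  move=> h; have /andP [/mem_belast hp hq] := mem_zip h.
  apply/and4P; split.
  - by apply: contraTneq hp => ->; rewrite inE negb_or vy.
  - by apply: contraTneq hq => ->.
  - by apply: contraTneq hq => ->.
  apply/negP=> /andP [/eqP ? /eqP ?]; subst p q.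
  by move: h; rewrite -El (negbTE (closing_edge _ t1)) //= yt.
have xy : x != y by apply: contraTneq xt => ->.
have vx : v != x by apply: contraTneq xt => <-.
rewrite /same_pair !xpair_eqE.
have excl p : [&& (p == v) ==> ~~ (p == x), (p == v) ==> ~~ (p == y) & (p == x) ==> ~~ (p == y)].
  apply/and3P; split; apply/implyP=> /eqP -> //; by rewrite eq_sym.
(* The claim now depends only on four edge memberships and on which of [v], [x], [y] equal [a] or
   [b]. It is checked for all truth values that [F1], [Z1] and [excl] permit. *)
move: (F1 a b) (F1 b a) (Z1 a b) (Z1 b a); move: (excl a) (excl b).
move: ((a, b) \in zip _ _) ((b, a) \in zip _ _) => z1 z2.
move: ((a, b) \in edges _) ((b, a) \in edges _) => f1 f2.
move: (a == v) (a == x) (a == y) (b == v) (b == x) (b == y).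
case; case; case; rewrite //=; case; case; case; rewrite //=.
all: case: z1; case: z2; case: f1; case: f2 => //=.
all: by do ?[move/(_ isT) => // | move=> _].
Qed.

Lemma packs_disj ns rs bs x y :
  packs ns rs bs -> ladj rs x y -> ladj bs x y = false.
Proof.
case/and5P=> _ _ _ _ /andP [_ /allrelP H] h; apply/negbTE.
by have /andP [hx hy] := mem_ladj h; have := H _ _ hx hy; rewrite h.
Qed.

Lemma mem_uadj ns rs bs x y : packs ns rs bs ->
  uadj rs bs x y -> (x \in flatten rs) && (y \in flatten rs).
Proof.
case/and5P=> _ _ _ _ /andP [/perm_mem e _] /orP [/mem_ladj //|/mem_ladj].
by rewrite -!e.
Qed.

(** Since the red edge [xy] and the blue edge [zw] are disjoint, no neighbour of [v] is both red and
    blue. Since every pair has at most one colour, the pairs [xy] and [zw] disappear from the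
    union. *)
Lemma pinch ns n rs bs c d x y z w v :
  packs (n :: ns) rs bs -> c \in rs -> d \in bs -> size c = n -> size d = n ->
  (x, y) \in cyc_edges c -> (z, w) \in cyc_edges d ->
  x \notin [:: z; w] -> y \notin [:: z; w] -> v \notin flatten rs ->
  exists rs' bs', [/\ packs (n.+1 :: ns) rs' bs',
    perm_eq (flatten rs') (v :: flatten rs)
  & forall a b, uadj rs' bs' a b =
      if a == v then b \in [:: x; y; z; w]
      else if b == v then a \in [:: x; y; z; w]
      else [&& uadj rs bs a b, ~~ same_pair a b x y & ~~ same_pair a b z w]].
Proof.
move=> P cr db sc sd exy ezw hx hy vr; have D := packs_disj P.
case/and5P: P => /= /andP [n3 a3] ps pb u /andP [pf _].
have ub : uniq (flatten bs) by rewrite -(perm_uniq pf).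
have vb : v \notin flatten bs by rewrite -(perm_mem pf).
rewrite -sc in n3 ps; have [rs' [pf1 ps1 e1]] := stretch u cr n3 exy vr ps.
rewrite sc -sd in n3; rewrite -sd in pb.
have [bs' [pf2 ps2 e2]] := stretch ub db n3 ezw vb pb.
rewrite sc in ps1; rewrite sd in ps2.
have X p : (p \in [:: x; y]) && (p \in [:: z; w]) = false.
  apply/negP=> /andP []; rewrite [_ \in [:: x; y]]inE mem_seq1.
  by case/orP=> /eqP ->; rewrite ?(negbTE hx) ?(negbTE hy).
have E a b : ladj rs' a b && ladj bs' a b = false.
  rewrite e1 e2; case: ifP => [_|_]; first exact: X.
  case: ifP => [_|_]; first exact: X.
  by apply/negP=> /andP [/andP [/D ->]].
exists rs', bs'; split=> //.
  apply/and5P; split=> //=.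
  - by rewrite a3 andbT -sd ltnW.
  - by rewrite (perm_uniq pf1) /= vr.
  apply/andP; split; last by apply/allrelP=> a b _ _; rewrite E.
  by rewrite (permPl pf1) (permPr pf2) perm_cons.
move=> a b; rewrite /uadj e1 e2; case: ifP => _.
  by rewrite !inE !orbA.
case: ifP => _; first by rewrite !inE !orbA.
have Hr : same_pair a b x y -> ladj rs a b.
  have h : (x, y) \in edges rs by apply/flatten_mapP; exists c.
  by rewrite /ladj; case/orP=> /eqP [-> ->]; rewrite h ?orbT.
have Hb : same_pair a b z w -> ladj bs a b.
  have h : (z, w) \in edges bs by apply/flatten_mapP; exists d.
  by rewrite /ladj; case/orP=> /eqP [-> ->]; rewrite h ?orbT.
move: Hr Hb (D a b); case: same_pair; case: same_pair; case: ladj; case: ladj => //=;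
by do ?[move/(_ isT) => // | move=> _].
Qed.

Lemma consec c y : uniq c -> 2 < size c -> y \in c ->
  exists a b, [/\ (y, a) \in cyc_edges c, (a, b) \in cyc_edges c & uniq [:: y; a; b]].
Proof.
move=> u sc /rot_to [i s E].
have ur : uniq (rot i c) by rewrite rot_uniq.
have sr : 2 < size (rot i c) by rewrite size_rot.
move: ur sr; rewrite E; case: s E => [|a [|b s]] // E us _; exists a, b.
rewrite -!(mem_rot i (cyc_edges c)) -cyc_edges_rot E /cyc_edges rot1_cons /= !inE !eqxx orbT; split=> //.
by move: us; rewrite /= !inE !negb_or => /andP [/and3P [-> -> _] /andP [/andP [-> _] _]].
Qed.

Lemma flatten_uniq_mem (T : eqType) (cs : seq (seq T)) c :
  uniq (flatten cs) -> c \in cs -> uniq c.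
Proof.
by elim: cs => //= c' cs IH; rewrite cat_uniq inE => /and3P [u _ us] /predU1P [-> //|]; exact: IH.
Qed.

(* On a blue path y a b, the edge ab avoids y and a is not a red neighbour of y, so
   ab meets at most one of the two red edges at y. *)
Lemma free_edges ns n rs bs c d :
  packs (n :: ns) rs bs -> c \in rs -> d \in bs -> size c = n -> size d = n ->
  exists x y z w, [/\ (x, y) \in cyc_edges c, (z, w) \in cyc_edges d,
    x \notin [:: z; w] & y \notin [:: z; w]].
Proof.
move=> P cr db sc sd; have D := packs_disj P.
case/and5P: P => /= /andP [n3 _] _ _ ur /andP [pf _].
have ub : uniq (flatten bs) by rewrite -(perm_uniq pf).
have uc := flatten_uniq_mem ur cr; have ud := flatten_uniq_mem ub db.
have nc : 2 < size c by rewrite sc.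
have nd : 2 < size d by rewrite sd.
have D' p q : (p, q) \in cyc_edges c -> ((p, q) \in cyc_edges d) || ((q, p) \in cyc_edges d) -> False.
  move=> h1 h2; suff: ladj bs p q by rewrite D // /ladj; apply/orP; left; apply/flatten_mapP; exists c.
  by case/orP: h2 => h2; apply/orP; [left|right]; apply/flatten_mapP; exists d.
have [x0 x0c] : exists x, x \in c by case: (c) nc => // x0 ? _; exists x0; exact: mem_head.
have [y [y' [exy eyy' /= /andP [xyy' /andP [yy' _]]]]] := consec uc nc x0c.
move: xyy' yy'; rewrite !inE negb_or => /andP [xy xy'] yy'.
have [yd|yd] := boolP (y \in d).
  have [a [b [eya eab /= /andP [yab _]]]] := consec ud nd yd.
  have xa : x0 != a by apply/eqP=> e; apply: (D' _ _ exy); rewrite e eya orbT.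
  have y'a : y' != a by apply/eqP=> e; apply: (D' _ _ eyy'); rewrite e eya.
  have [e|xb] := eqVneq x0 b.
    exists y, y', a, b; split=> //; rewrite !inE negb_or y'a -e eq_sym //.
  by exists x0, y, a, b; split=> //; rewrite !inE negb_or xa.
(* When [y] is off the blue cycle, only [x0] has to be avoided: by the edge following the one that
   leaves [x0], or by any edge if [x0] is off the cycle too. *)
have dsub a b : (a, b) \in cyc_edges d -> y \notin [:: a; b].
  move=> /mem_cyc_edges /andP [ha hb]; rewrite !inE; apply/norP.
  by split; apply: contraNneq yd => ->.
have [xd|xd] := boolP (x0 \in d).
  have [a [b [_ eab /= /andP [xab _]]]] := consec ud nd xd.
  by exists x0, y, a, b; split=> //; apply: dsub.
have [z zd] : exists z, z \in d by case: (d) nd => // z ? _; exists z; exact: mem_head.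
have [a [b [eza _ _]]] := consec ud nd zd.
exists x0, y, z, a; split=> //; last exact: dsub.
have /andP [_ ad] := mem_cyc_edges eza.
by rewrite !inE; apply/norP; split; apply: contraNneq xd => ->.
Qed.

(** A predicate constant along edges is the indicator of a union of components; quantifying over
    these predicates avoids handling paths. *)
Definition connected (u : rel nat) (V : seq nat) :=
  forall A : pred nat, (forall a b, u a b -> A a = A b) ->
    {in V &, forall a b, A a = A b}.

Definition clique4 (u : rel nat) (V f : seq nat) :=
  [/\ size f = 4, uniq f, {subset f <= V} &
      {in f &, forall p q, p != q -> u p q}].

Definition K4_free u V := forall f, ~ clique4 u V f.

Lemma fresh (s : seq nat) : exists v, v \notin s.
Proof.
have /allPn [v _ hv] : ~~ all (mem s) (iota 0 (size s).+1).
  apply/negP=> /allP h; have := uniq_leq_size (iota_uniq 0 _) h.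
  by rewrite size_iota ltnn.
by exists v.
Qed.

Lemma perm_shape_mem n ns (cs : seq (seq nat)) :
  perm_eq (shape cs) (n :: ns) -> exists2 c, c \in cs & size c = n.
Proof.
move/perm_mem=> /(_ n); rewrite mem_head => /mapP [c h e]; by exists c.
Qed.

Lemma cyc_edges_neq c x y :
  uniq c -> 1 < size c -> (x, y) \in cyc_edges c -> x != y.
Proof.
move=> u sc /cyc_edge_rot [k [t [E El]]].
move: u sc; rewrite -(rot_uniq k) -(size_rot k) E /= => /andP [yt _].
by case: t yt El {E} => // t0 t yt /= El _; apply: contraNneq yt => <-; rewrite -El mem_last.
Qed.

Lemma cyc_edges_prev c x y : uniq c -> (x, y) \in cyc_edges c -> prev c y = x.
Proof.
move=> u /cyc_edge_rot [k [t [E <-]]]; rewrite -(prev_rot k u) E prev_nth mem_head.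
have yt : y \notin t by move: u; rewrite -(rot_uniq k) E => /andP [].
by rewrite memNindex // (last_nth y).
Qed.

(** Each deleted edge is replaced by a path through [v], so connectedness survives. A new K4 would
    have to contain [v] and three of [x], [y], [z], [w], hence both ends of a deleted edge. *)
Lemma lengthen ns n rs bs : packs (n :: ns) rs bs ->
  exists rs' bs', [/\ packs (n.+1 :: ns) rs' bs',
    connected (uadj rs bs) (flatten rs) -> connected (uadj rs' bs') (flatten rs')
  & K4_free (uadj rs bs) (flatten rs) -> K4_free (uadj rs' bs') (flatten rs')].
Proof.
move=> P; have /and5P [_ ps pb _ _] := P.
have [c cr sc] := perm_shape_mem ps; have [d db sd] := perm_shape_mem pb.
have [x [y [z [w [exy ezw hx hy]]]]] := free_edges P cr db sc sd.
have [v vr] := fresh (flatten rs).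
have [rs' [bs' [P' pf E]]] := pinch P cr db sc sd exy ezw hx hy vr.
have old a : a \in flatten rs -> a == v = false.
  by move=> h; apply/negbTE; apply: contraNneq vr => <-.
have uxy : uadj rs bs x y.
  by apply/orP; left; apply/orP; left; apply/flatten_mapP; exists c.
have uzw : uadj rs bs z w.
  by apply/orP; right; apply/orP; left; apply/flatten_mapP; exists d.
have /andP [xr yr] := mem_uadj P uxy; have /andP [zr wr] := mem_uadj P uzw.
exists rs', bs'; split=> // [C A hA|C f [sf uf sub h]].
  have Av a : a \in [:: x; y; z; w] -> A v = A a by move=> h; apply: hA; rewrite E eqxx.
  have Au a b : uadj rs bs a b -> A a = A b.
    move=> h; have /andP [ar br] := mem_uadj P h.
    have [/orP [] /eqP [-> ->]|h1] := boolP (same_pair a b x y);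
      [by rewrite -!Av // !inE eqxx ?orbT..|].
    have [/orP [] /eqP [-> ->]|h2] := boolP (same_pair a b z w);
      [by rewrite -!Av // !inE eqxx ?orbT..|].
    by apply: hA; rewrite E !old // h h1 h2.
  have Vv a : a \in flatten rs' -> A a = A x.
    rewrite (perm_mem pf) inE => /predU1P [->|ha]; first by apply: Av; rewrite mem_head.
    exact: (C A Au).
  by move=> a b /Vv -> /Vv ->.
have nxy : uadj rs' bs' x y = false.
  by rewrite E !old // /same_pair eqxx /= !andbF.
have nzw : uadj rs' bs' z w = false.
  by rewrite E !old // /same_pair eqxx /= !andbF.
have [vf|vf] := boolP (v \in f); last first.
  have fv p : p \in f -> p == v = false by move=> hp; apply/negbTE; apply: contraNneq vf => <-.
  apply: (C f); split=> // [p hp|p q hp hq pq].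
    by move: (sub _ hp); rewrite (perm_mem pf) inE fv.
  by have := h _ _ hp hq pq; rewrite E !fv // => /and3P [].
pose g := rem v f.
have sg : size g = 3 by rewrite size_rem // sf.
have ug : uniq g by exact: rem_uniq.
have gf p : p \in g -> (p != v) && (p \in f) by rewrite mem_rem_uniq.
have g4 : {subset g <= [:: x; y; z; w]}.
  by move=> p /gf /andP [pv pf']; have := h v p vf pf'; rewrite eq_sym pv E eqxx; exact.
have two a b : {subset g <= [:: a; b]} -> False.
  by move/(uniq_leq_size ug); rewrite sg.
have pick a b : a != b -> uadj rs' bs' a b = false -> (a \notin g) || (b \notin g).
  move=> ab nab; rewrite -negb_and; apply/negP=> /andP [/gf /andP [_ ha] /gf /andP [_ hb]].
  by rewrite (h a b) in nab.
have ub : uniq (flatten bs).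
  by case/and5P: P => _ _ _ u /andP [pf' _]; rewrite -(perm_uniq pf').
have n3 : 2 < n by case/and5P: P => /andP [].
have nnx : x != y by apply: cyc_edges_neq exy; [apply: flatten_uniq_mem cr; case/and5P: P | rewrite sc ltnW].
have nnz : z != w by apply: cyc_edges_neq ezw; [apply: flatten_uniq_mem db | rewrite sd ltnW].
have sub2 a b p q : {subset [:: x; y; z; w] <= [:: a; b; p; q]} -> a \notin g -> b \notin g -> {subset g <= [:: p; q]}.
  move=> s ha hb i ig; have := s _ (g4 _ ig); rewrite inE => /predU1P [e|].
    by rewrite -e ig in ha.
  by rewrite inE => /predU1P [e|//]; rewrite -e ig in hb.
(* One end of each deleted edge is missing from [g], which leaves two candidates for its three
   vertices. *)
have [h1|h1] := orP (pick _ _ nnx nxy); have [h2|h2] := orP (pick _ _ nnz nzw).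
- by apply: (two y w); apply: (sub2 x z) => // i; rewrite !inE => /or4P [] ->; rewrite ?orbT.
- by apply: (two y z); apply: (sub2 x w) => // i; rewrite !inE => /or4P [] ->; rewrite ?orbT.
- by apply: (two x w); apply: (sub2 y z) => // i; rewrite !inE => /or4P [] ->; rewrite ?orbT.
- by apply: (two x z); apply: (sub2 y w) => // i; rewrite !inE => /or4P [] ->; rewrite ?orbT.
Qed.

(** The pinched edges start at [x] and [z] outside the clique, so none of its edges is deleted. For
    the edges to be disjoint, [z] also avoids [x], [y] and their blue predecessors: with the clique
    at most eight vertices, whence the bound on [n]. *)
Lemma lengthen_clique ns n rs bs f : 8 < n -> packs (n :: ns) rs bs ->
  clique4 (uadj rs bs) (flatten rs) f ->
  exists rs' bs', packs (n.+1 :: ns) rs' bs' /\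
    clique4 (uadj rs' bs') (flatten rs') f.
Proof.
move=> n8 P [sf uf sub h]; have /and5P [_ ps pb ur /andP [pf' _]] := P.
have [c cr sc] := perm_shape_mem ps; have [d db sd] := perm_shape_mem pb.
have uc := flatten_uniq_mem ur cr.
have ud : uniq d by apply: flatten_uniq_mem db; rewrite -(perm_uniq pf').
have [x xc xf] : exists2 x, x \in c & x \notin f.
  apply/allPn/negP=> /allP hs; have := uniq_leq_size uc hs; by rewrite sc sf => /(leq_trans n8).
have [y [_ [exy _ _]]] : exists y y', [/\ (x, y) \in cyc_edges c, (y, y') \in cyc_edges c & uniq [:: x; y; y']].
  by apply: consec => //; rewrite sc (leq_trans _ n8).
have [z [zd]] : exists z, z \in d /\ z \notin f ++ [:: x; y; prev d x; prev d y].
  have /allPn [z h1 h2] : ~~ all (mem (f ++ [:: x; y; prev d x; prev d y])) d.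
    apply/negP=> /allP hs; have := uniq_leq_size ud hs; by rewrite size_cat /= sd sf leqNgt n8.
  by exists z.
rewrite mem_cat negb_or !inE => /andP [zf /norP [zx /norP [zy /norP [zpx zpy]]]].
have [w [_ [ezw _ _]]] : exists w w', [/\ (z, w) \in cyc_edges d, (w, w') \in cyc_edges d & uniq [:: z; w; w']].
  by apply: consec => //; rewrite sd (leq_trans _ n8).
have nzw := cyc_edges_prev ud ezw.
have hx : x \notin [:: z; w].
  rewrite !inE eq_sym (negbTE zx) /=; apply: contraNneq zpx => ->; by rewrite nzw.
have hy : y \notin [:: z; w].
  rewrite !inE eq_sym (negbTE zy) /=; apply: contraNneq zpy => ->; by rewrite nzw.
have [v vr] := fresh (flatten rs).
have [rs' [bs' [P' pf E]]] := pinch P cr db sc sd exy ezw hx hy vr.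
exists rs', bs'; split=> //; split=> // [p hp|p q hp hq pq].
  by rewrite (perm_mem pf) inE sub ?orbT.
have old a : a \in f -> a == v = false.
  by move=> ha; apply/negbTE; apply: contraNneq vr => <-; exact: sub.
rewrite E !old // h //= /same_pair !xpair_eqE.
have fx a : a \in f -> a == x = false by move=> ha; apply: contraNF xf => /eqP <-.
have fz a : a \in f -> a == z = false by move=> ha; apply: contraNF zf => /eqP <-.
by rewrite !fx // !fz // !andbF.
Qed.

(** * Relabelling, disjoint unions and the addition of a triangle *)

Lemma edges_map (h : nat -> nat) cs :
  edges (map (map h) cs) = [seq (h e.1, h e.2) | e <- edges cs].
Proof.
rewrite /edges -map_comp map_flatten -map_comp; congr flatten; apply: eq_map => c /=.
rewrite /cyc_edges -map_rot; elim: c (rot 1 c) => [|x c IH] [|y d] //=.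
by rewrite IH.
Qed.

Lemma ladj_map (h : nat -> nat) cs x y :
  injective h -> ladj (map (map h) cs) (h x) (h y) = ladj cs x y.
Proof.
move=> hi; rewrite /ladj !edges_map.
have hi2 : injective (fun e : nat * nat => (h e.1, h e.2)).
  by move=> [a b] [c d] /= [/hi -> /hi ->].
by rewrite (mem_map hi2 _ (x, y)) (mem_map hi2 _ (y, x)).
Qed.

Lemma shape_map (h : nat -> nat) cs : shape (map (map h) cs) = shape cs.
Proof. by rewrite /shape -map_comp; apply: eq_map => c; rewrite /= size_map. Qed.

Lemma packs_map (h : nat -> nat) ns rs bs : injective h ->
  packs ns rs bs -> packs ns (map (map h) rs) (map (map h) bs).
Proof.
move=> hi /and5P [a3 ps pb u /andP [pf /allrelP nc]].
apply/and5P; rewrite !shape_map -!map_flatten (map_inj_uniq hi); split=> //.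
rewrite (perm_map h pf); apply/allrelP=> _ _ /mapP [x hx ->] /mapP [y hy ->].
by rewrite !ladj_map // nc.
Qed.

Lemma edges_cat cs cs' : edges (cs ++ cs') = edges cs ++ edges cs'.
Proof. by rewrite /edges map_cat flatten_cat. Qed.

Lemma ladj_cat cs cs' x y : ladj (cs ++ cs') x y = ladj cs x y || ladj cs' x y.
Proof. by rewrite /ladj edges_cat !mem_cat orbACA. Qed.

Lemma seq_bound (s : seq nat) : exists M, all (ltn^~ M) s.
Proof.
elim: s => [|x s [M /allP hM]]; first by exists 0.
exists (maxn x.+1 M) => /=; rewrite leq_maxl.
by apply/allP=> y /hM h; exact: leq_trans h (leq_maxr _ _).
Qed.

Lemma packs_nonempty ns rs bs : packs ns rs bs -> 0 < size ns ->
  exists x, x \in flatten rs.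
Proof.
case: ns => // n ns /and5P [/= /andP [n3 _] ps _ _ _] _.
have [c cr sc] := perm_shape_mem ps.
case: c sc cr => [e|x c _ cr]; first by rewrite -e in n3.
by exists x; apply/flattenP; exists (x :: c); rewrite ?mem_head.
Qed.

(** The second packing is relabelled above a bound [M] on the labels of the first. The predicate
    [y < M] is then constant along edges but not on all vertices. *)
Lemma packs_union ns1 ns2 rs1 bs1 rs2 bs2 : 0 < size ns1 -> 0 < size ns2 ->
  packs ns1 rs1 bs1 -> packs ns2 rs2 bs2 ->
  exists rs bs, packs (ns1 ++ ns2) rs bs /\ ~ connected (uadj rs bs) (flatten rs).
Proof.
move=> n1 n2 P1 P2'; have [M /allP hM0] := seq_bound (flatten rs1).
have hM y : y \in flatten rs1 -> y < M := hM0 y.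
have := packs_map (@addnI M) P2'; have [x0 hx0] := packs_nonempty P2' n2.
have : M + x0 \in flatten (map (map (addn M)) rs2) by rewrite -map_flatten map_f.
have: forall y, y \in flatten (map (map (addn M)) rs2) -> M <= y.
  by move=> y; rewrite -map_flatten => /mapP [z _ ->]; exact: leq_addr.
move: (map _ rs2) (map _ bs2) (M + x0) => {hx0 x0 P2'}rs2 {}bs2 x0 hM2 hx0 P2.
have [x1 hx1] := packs_nonempty P1 n1.
have dis y : y \in flatten rs1 -> y \in flatten rs2 -> False.
  by move=> /hM h /hM2; rewrite leqNgt h.
have D1 := packs_disj P1; have D2 := packs_disj P2.
have M1 := @mem_uadj _ _ _ _ _ P1; have M2 := @mem_uadj _ _ _ _ _ P2.
exists (rs1 ++ rs2), (bs1 ++ bs2); split; last first.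
  move/(_ (fun y => y < M)) => C.
  have E : (x1 < M) = (x0 < M).
    apply: C; rewrite ?flatten_cat ?mem_cat ?hx1 ?hx0 ?orbT //.
    move=> a b; rewrite /uadj !ladj_cat orbACA => /orP [/M1/andP [ha hb]|/M2/andP [ha hb]].
      by rewrite !hM.
    by rewrite !ltnNge !hM2.
  by rewrite hM // ltnNge hM2 in E.
case/and5P: P1 => a1 ps1 pb1 u1 /andP [pf1 _].
case/and5P: P2 => a2 ps2 pb2 u2 /andP [pf2 _].
rewrite /packs all_cat a1 a2 /shape !map_cat !flatten_cat cat_uniq u1 u2 !perm_cat //= andbT.
apply/andP; split.
  by apply/hasPn=> y h2; apply/negP=> h1; exact: dis h2.
apply/allrelP=> a b _ _; rewrite !ladj_cat; apply/negP=> /andP [].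
have L1 x y : ladj rs1 x y -> (x \in flatten rs1) by case/mem_ladj/andP.
have L2 x y : ladj rs2 x y -> (x \in flatten rs2) by case/mem_ladj/andP.
have L3 x y : ladj bs1 x y -> (x \in flatten rs1) by case/mem_ladj/andP; rewrite -(perm_mem pf1).
have L4 x y : ladj bs2 x y -> (x \in flatten rs2) by case/mem_ladj/andP; rewrite -(perm_mem pf2).
case/orP=> h1 /orP [h2|h2].
- by rewrite D1 in h2.
- exact: dis (L1 _ _ h1) (L4 _ _ h2).
- exact: dis (L3 _ _ h2) (L2 _ _ h1).
- by rewrite D2 in h2.
Qed.

(* The new red triangle is f g1 g2, the new blue one f e1 e2, and g1, g2 take the
   places of e1, e2 in the old blue cycles. *)
Lemma add_triangle ns rs bs e1 e2 : packs ns rs bs ->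
  e1 \in flatten rs -> e2 \in flatten rs -> e1 != e2 -> ~~ uadj rs bs e1 e2 ->
  connected (uadj rs bs) (flatten rs) ->
  exists rs' bs', [/\ packs (3 :: ns) rs' bs',
    connected (uadj rs' bs') (flatten rs') &
    exists f p, [/\ f \in flatten rs', p \in flatten rs', f != p & ~~ uadj rs' bs' f p]].
Proof.
move=> P e1V e2V e12 ne C.
have [f fV] := fresh (flatten rs).
have [g1] := fresh (f :: flatten rs); rewrite inE negb_or => /andP [g1f g1V].
have [g2] := fresh (g1 :: f :: flatten rs); rewrite !inE !negb_or => /and3P [g21 g2f g2V].
have nV a v : v \notin flatten rs -> a \in flatten rs -> (a == v) = false.
  by move=> hv ha; apply: contraNF hv => /eqP <-.
pose sw x := if x == e1 then g1 else if x == e2 then g2 else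
  if x == g1 then e1 else if x == g2 then e2 else x.
have fe1 : f == e1 = false by rewrite eq_sym nV.
have fe2 : f == e2 = false by rewrite eq_sym nV.
have g1e1 : g1 == e1 = false by rewrite eq_sym nV.
have g1e2 : g1 == e2 = false by rewrite eq_sym nV.
have g2e1 : g2 == e1 = false by rewrite eq_sym nV.
have g2e2 : g2 == e2 = false by rewrite eq_sym nV.
have swe1 : sw e1 = g1 by rewrite /sw eqxx.
have swe2 : sw e2 = g2 by rewrite /sw eq_sym (negbTE e12) eqxx.
have swg1 : sw g1 = e1 by rewrite /sw g1e1 g1e2 eqxx.
have swg2 : sw g2 = e2 by rewrite /sw g2e1 g2e2 (negbTE g21) eqxx.
have swo a : a != e1 -> a != e2 -> a != g1 -> a != g2 -> sw a = a.
  by rewrite /sw; do 4 case: ifP => // _.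
have swf : sw f = f by rewrite swo ?fe1 ?fe2 // eq_sym.
have swK : involutive sw.
  move=> a; have [->|h1] := eqVneq a e1; first by rewrite swe1.
  have [->|h2] := eqVneq a e2; first by rewrite swe2.
  have [->|h3] := eqVneq a g1; first by rewrite swg1.
  have [->|h4] := eqVneq a g2; first by rewrite swg2.
  by rewrite !swo.
have swi := inv_inj swK.
have Eb x y : ladj (map (map sw) bs) x y = ladj bs (sw x) (sw y).
  by rewrite -(ladj_map bs (sw x) (sw y) swi) !swK.
have D := packs_disj P; have M := @mem_uadj _ _ _ _ _ P.
have Mr x y : ladj rs x y -> (x \in flatten rs) && (y \in flatten rs).
  by move=> h; apply: M; rewrite /uadj h.
have Mb x y : ladj bs x y -> (x \in flatten rs) && (y \in flatten rs).
  by move=> h; apply: M; rewrite /uadj h orbT.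
have tri a b c x y cs : ladj ([:: a; b; c] :: cs) x y =
    [|| same_pair x y a b, same_pair x y b c, same_pair x y c a | ladj cs x y].
  rewrite /ladj /edges /= -/(edges cs) !inE /same_pair !xpair_eqE.
  case: (x == a); case: (x == b); case: (x == c); case: (y == a);
  case: (y == b); case: (y == c); case: (_ \in _); case: (_ \in _) => //.
have same (R : rel nat) x y a b : symmetric R -> R a b = false ->
    same_pair x y a b -> R x y = false.
  by move=> Rs Rab /orP [] /eqP [-> ->]; rewrite // Rs.
pose rs' := [:: f; g1; g2] :: rs.
pose bs' := [:: f; e1; e2] :: map (map sw) bs.
have Er x y := tri f g1 g2 x y rs; have Eb' x y := tri f e1 e2 x y (map (map sw) bs).
have sp x y a b : same_pair x y a b = ((x == a) && (y == b)) || ((x == b) && (y == a)).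
  by rewrite /same_pair !xpair_eqE.
have nb1 x y : x \notin flatten rs -> ladj bs x y = false.
  by move=> h; apply: contraNF h => /Mb /andP [].
have nb2 x y : y \notin flatten rs -> ladj bs x y = false.
  by move=> h; apply: contraNF h => /Mb /andP [].
have [ner neb] : ladj rs e1 e2 = false /\ ladj bs e1 e2 = false.
  by move: ne; rewrite /uadj; case: ladj; case: ladj.
have Vf a : a \in flatten rs -> [&& a != f, a != g1 & a != g2].
  by move=> h; rewrite !nV.
(* The non-adjacency of [e1] and [e2] enters twice: the new red pair [g1], [g2] would be blue if
   [e1], [e2] had been, and the pair [e1], [e2] itself becomes blue. *)
have conf a b : ladj rs' a b && ladj bs' a b = false.
  apply/negP=> /andP []; rewrite Er => /or4P [h|h|h|h].
  - rewrite (same (ladj bs') _ _ _ _ (@ladj_sym _) _ h) // Eb' Eb swf nb1 // !sp.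
    by rewrite fe1 fe2 (negbTE g1f) g1e1 g1e2 /= !andbF.
  - rewrite (same (ladj bs') _ _ _ _ (@ladj_sym _) _ h) // Eb' Eb swg1 swg2 neb !sp.
    by rewrite g1e1 g1e2 g2e1 g2e2 (negbTE g2f) /= !andbF.
  - rewrite (same (ladj bs') _ _ _ _ (@ladj_sym _) _ h) // Eb' Eb swf nb2 // !sp.
    by rewrite fe1 fe2 (negbTE g2f) g2e1 g2e2 /= ?andbF.
  rewrite Eb' => /or4P [k|k|k|].
  - by rewrite (same (ladj rs) _ _ _ _ (@ladj_sym _) _ k) // in h; apply: contraNF fV => /Mr /andP [].
  - by rewrite (same (ladj rs) _ _ _ _ (@ladj_sym _) _ k) in h.
  - by rewrite (same (ladj rs) _ _ _ _ (@ladj_sym _) _ k) // in h; apply: contraNF fV => /Mr /andP [].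
  have /andP [/Vf /and3P [af ag1 ag2] /Vf /and3P [bf bg1 bg2]] := Mr _ _ h.
  rewrite Eb; have [->|ae1] := eqVneq a e1; first by rewrite swe1 nb1.
  have [->|ae2] := eqVneq a e2; first by rewrite swe2 nb1.
  have [->|be1] := eqVneq b e1; first by rewrite swe1 nb2.
  have [->|be2] := eqVneq b e2; first by rewrite swe2 nb2.
  by rewrite !swo // D.
have /and5P [a3 ps pb u /andP [pf _]] := P.
have msw a : (a \in map sw (flatten bs)) = (sw a \in flatten rs).
  by rewrite -{1}(swK a) (mem_map swi) (perm_mem pf).
exists rs', bs'; split.
- apply/and5P; split=> //=.
  + by rewrite perm_cons.
  + by rewrite shape_map perm_cons.
  + by rewrite !inE !negb_or u fV g1V g2V !andbT eq_sym g1f eq_sym g2f eq_sym g21.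
  apply/andP; split; last by apply/allrelP=> a b _ _; rewrite conf.
  apply: uniq_perm.
  + by rewrite /= !inE !negb_or u fV g1V g2V !andbT eq_sym g1f eq_sym g2f eq_sym g21.
  + rewrite /= !inE !negb_or fe1 fe2 e12 -map_flatten (map_inj_uniq swi) -(perm_uniq pf) u.
    by rewrite !msw swf swe1 swe2 fV g1V g2V.
  move=> a; rewrite /= !inE -map_flatten msw.
  have [->|ae1] := eqVneq a e1; first by rewrite e1V !orbT.
  have [->|ae2] := eqVneq a e2; first by rewrite e2V !orbT.
  have [->|ag1] := eqVneq a g1; first by rewrite swg1 e1V !orbT.
  have [->|ag2] := eqVneq a g2; first by rewrite swg2 e2V !orbT.
  by rewrite swo.
- move=> A hA.
  have HB x y : ladj bs' x y -> A x = A y by move=> h; apply: hA; rewrite /uadj h orbT.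
  have HR x y : ladj rs' x y -> A x = A y by move=> h; apply: hA; rewrite /uadj h.
  have Ag1 : A g1 = A f by symmetry; apply: HR; rewrite Er sp !eqxx.
  have Ag2 : A g2 = A f by apply: HR; rewrite Er !sp !eqxx !orbT.
  have Ae1 : A e1 = A f by symmetry; apply: HB; rewrite Eb' sp !eqxx.
  have Ae2 : A e2 = A f by apply: HB; rewrite Eb' !sp !eqxx !orbT.
  (* All four swapped vertices have the value of [f], so [A] is also constant along the old blue
     edges in their original position. *)
  have Asw a : A (sw a) = A a.
    have [->|ae1] := eqVneq a e1; first by rewrite swe1 Ag1 Ae1.
    have [->|ae2] := eqVneq a e2; first by rewrite swe2 Ag2 Ae2.
    have [->|ag1] := eqVneq a g1; first by rewrite swg1 Ag1 Ae1.
    have [->|ag2] := eqVneq a g2; first by rewrite swg2 Ag2 Ae2.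
    by rewrite swo.
  have CA : {in flatten rs, forall a, A a = A f}.
    move=> a ha; rewrite -Ae1; apply: (C A) => // x y /orP [h|h].
      by apply: HR; rewrite Er h !orbT.
    by rewrite -(Asw x) -(Asw y); apply: HB; rewrite Eb' Eb !swK h !orbT.
  have CV a : a \in flatten rs' -> A a = A f.
    by rewrite /= !inE => /or4P [/eqP ->|/eqP ->|/eqP ->|/CA].
  by move=> a b /CV -> /CV ->.
(* The non-adjacent pair for the next round is [f] with a red neighbour [p] of [e1]: the neighbours
   of [f] are [g1], [g2], [e1], [e2], and [p] is not [e2] because [e1], [e2] are not
   red-adjacent. *)
have [c cr e1c] := flattenP e1V.
have c3 : 2 < size c.
  by have := allP a3 (size c); rewrite -(perm_mem ps) map_f // => /(_ isT).
have [p [p' [e1p _ up]]] := consec (flatten_uniq_mem u cr) c3 e1c.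
have rp : ladj rs e1 p by rewrite /ladj; apply/orP; left; apply/flatten_mapP; exists c.
have /andP [_ pV] := Mr _ _ rp; have /and3P [pf' pg1 pg2] := Vf _ pV.
exists f, p; split.
- by rewrite /= mem_head.
- by rewrite /= !inE pV !orbT.
- by rewrite eq_sym.
have pe1 : p != e1 by apply: contraTneq up => ->; rewrite /= mem_head.
have pe2 : p != e2 by apply: contraTneq rp => ->; rewrite ner.
rewrite /uadj Er Eb' Eb swf nb1 // !sp (negbTE pf') (negbTE pg1) (negbTE pg2).
rewrite (negbTE pe1) (negbTE pe2) /= !andbF !orbF /=.
by apply: contra fV => /Mr /andP [].
Qed.

(** * Packings of all cycle types *)

(* [all], stopping at the first failure even under call-by-value, where [&&]
   evaluates both its arguments. *)
Fixpoint lazy_all (T : Type) (f : T -> bool) (s : seq T) : bool :=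
  if s is x :: s' then if f x then lazy_all f s' else false else true.

Lemma lazy_allE (T : Type) (f : T -> bool) s : lazy_all f s = all f s.
Proof. by elim: s => //= x s ->; case: (f x). Qed.

(** Backtracking search that prunes a prefix as soon as [ok] fails. With [leaf] constantly false it
    asserts that no admissible sequence exists, so its negation produces one. *)
Fixpoint all_ext (V : seq nat) (ok : seq nat -> nat -> bool)
    (leaf : seq nat -> bool) (m : nat) (p : seq nat) : bool :=
  if m is m'.+1 then
    lazy_all (fun x => if ok p x then all_ext V ok leaf m' (rcons p x) else true) V
  else leaf p.

Definition admissible (V : seq nat) (ok : seq nat -> nat -> bool) m p q :=
  [/\ size q = m, {subset q <= V} &
      forall i, i < m -> ok (p ++ take i q) (nth 0 q i)].

Lemma admissible_cons V (ok : seq nat -> nat -> bool) m p x q : x \in V -> ok p x ->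
  admissible V ok m (rcons p x) q -> admissible V ok m.+1 p (x :: q).
Proof.
move=> xV okx [sq sub h]; split=> [||[|i] im] /=; rewrite ?cats0 ?sq //.
  by move=> y; rewrite inE => /predU1P [-> //|]; exact: sub.
by have := h i im; rewrite cat_rcons.
Qed.

Lemma all_ext_true V ok leaf m p q :
  all_ext V ok leaf m p -> admissible V ok m p q -> leaf (p ++ q).
Proof.
elim: m p q => [|m IH] p [|x q] /= H [//= sq sub h]; first by rewrite cats0.
rewrite lazy_allE in H.
rewrite -cat_rcons; apply: IH.
  have xV : x \in V by apply: sub; exact: mem_head.
  by have := allP H x xV; have := h 0 isT; rewrite /= cats0 => ->.
case: sq => sq; split=> // [y hy|i im]; first by apply: sub; rewrite inE hy orbT.
by have := h i.+1 im; rewrite /= cat_rcons.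
Qed.

Lemma all_ext_false V ok leaf m p :
  ~~ all_ext V ok leaf m p -> exists2 q, admissible V ok m p q & ~~ leaf (p ++ q).
Proof.
elim: m p => [|m IH] p /=; first by exists [::]; rewrite ?cats0.
rewrite lazy_allE => /allPn [x xV]; case: ifP => // okx /IH [q hq]; rewrite cat_rcons.
by exists (x :: q) => //; exact: admissible_cons.
Qed.

(** The vertices of [H] are the positions in [f]; the copy need not be induced. *)
Definition contains (u : rel nat) (V : seq nat) m (H : seq (nat * nat)) (f : seq nat) :=
  [/\ size f = m, uniq f, {subset f <= V} &
      {in H, forall e, u (nth 0 f e.1) (nth 0 f e.2)}].

(** An edge is tested when its second end is placed, which is why edge lists are written with the
    smaller end first. *)
Definition extends_copy (u : rel nat) (H : seq (nat * nat)) p x :=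
  if x \in p then false else
  lazy_all (fun e => if e.2 == size p then u (nth 0 p e.1) x else true) H.

Definition avoids (u : rel nat) V m H :=
  all_ext V (extends_copy u H) (fun=> false) m [::].

Lemma avoidsP u V m H f : all (fun e => e.1 < e.2) H ->
  avoids u V m H -> ~ contains u V m H f.
Proof.
move=> /allP Hlt av [sf uf sub h]; suff: admissible V (extends_copy u H) m [::] f.
  by move/(all_ext_true av).
split=> // i im; rewrite /extends_copy /= lazy_allE ifN.
  apply/allP=> e eH; rewrite size_takel ?sf 1?ltnW //; case: eqP => // ei.
  by rewrite nth_take -?ei ?Hlt // h.
move: uf; rewrite -{1}(cat_take_drop i f) (drop_nth 0) ?sf // cat_uniq.
by case/and3P=> _ /hasPn /(_ _ (mem_head _ _)).
Qed.

Definition K4_edges := [:: (0, 1); (0, 2); (1, 2); (0, 3); (1, 3); (2, 3)].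

Definition prism_edges :=
  [:: (0, 1); (0, 2); (1, 2); (0, 3); (1, 4); (3, 4); (2, 5); (3, 5); (4, 5)].

Lemma K4_free_avoids u V : avoids u V 4 K4_edges -> K4_free u V.
Proof.
move=> av f [sf uf sub h]; apply: (avoidsP (f := f) _ av) => //; split=> //.
have nn i j : i < j < 4 -> u (nth 0 f i) (nth 0 f j).
  move=> /andP [ij j4]; have i4 := ltn_trans ij j4.
  by apply: h; rewrite ?mem_nth ?sf // nth_uniq ?sf // ltn_eqF.
by move=> e; rewrite !inE; do 5 (case/predU1P=> [->|]; first exact: nn); move/eqP->; exact: nn.
Qed.

(** Every vertex must have a neighbour listed before it. Success proves connectedness, whereas
    failure may be due to the order of [l]. *)
Fixpoint reach (u : rel nat) (seen l : seq nat) : bool :=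
  if l is x :: l' then has (u x) seen && reach u (x :: seen) l' else true.

Lemma reachP u x l : reach u [:: x] l -> connected u (x :: l).
Proof.
move=> R A hA; suff S : {in x :: l, forall a, A a = A x}.
  by move=> a b /S -> /S ->.
suff gen seen : {in seen, forall a, A a = A x} -> reach u seen l ->
    {in l, forall a, A a = A x}.
  move=> a; rewrite inE => /predU1P [-> //|]; apply: gen R a.
  by move=> a; rewrite inE => /eqP ->.
move=> {R}; elim: l seen => //= y l IH seen hs /andP [/hasP [z zs uyz] R] a.
have hy : A y = A x by rewrite (hA _ _ uyz) hs.
rewrite inE => /predU1P [-> //|]; apply: IH R a => a.
by rewrite inE => /predU1P [-> //|]; exact: hs.
Qed.

(** Normal form of the red cycles as runs of consecutive integers, so that only the blue cycles of a
    concrete packing have to be given. *)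
Definition blocks ns := reshape ns (iota 0 (sumn ns)).

Lemma packs_perm ns ns' rs bs : perm_eq ns ns' -> packs ns rs bs -> packs ns' rs bs.
Proof.
move=> p /and5P [a ps pb u r]; apply/and5P.
by rewrite -(perm_all _ p) -(permPr p) -(permPr p).
Qed.

(** Any entry can be permuted to the front, incremented there as often as required, and moved
    back. *)
Lemma lengthening_closed (Q : seq nat -> Prop) :
  (forall ns ns', perm_eq ns ns' -> Q ns -> Q ns') ->
  (forall n ns, Q (n :: ns) -> Q (n.+1 :: ns)) ->
  forall ns ns', all2 leq ns ns' -> Q ns -> Q ns'.
Proof.
move=> Qp Ql ns ns' le; suff gen pre : Q (pre ++ ns) -> Q (pre ++ ns') by exact: (gen [::]).
elim: ns ns' pre le => [|a ns IH] [|b ns'] pre //= /andP [ab h] q.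
rewrite -cat_rcons; apply: IH h _; rewrite cat_rcons.
have pm c : perm_eq (pre ++ c :: ns) (c :: pre ++ ns).
  by rewrite -cat1s perm_catCA.
apply: (Qp (b :: pre ++ ns)); first by rewrite perm_sym pm.
have := Qp _ _ (pm a) q; rewrite -(subnK ab); elim: (b - a) => //= k IHk /IHk.
exact: Ql.
Qed.

Definition conn_packing ns :=
  exists rs bs, packs ns rs bs /\ connected (uadj rs bs) (flatten rs).

Definition K4_free_packing ns :=
  exists rs bs, packs ns rs bs /\ K4_free (uadj rs bs) (flatten rs).

Definition K4_packing ns :=
  exists rs bs, packs ns rs bs /\ exists f, clique4 (uadj rs bs) (flatten rs) f.

Lemma conn_packing_le ns ns' : all2 leq ns ns' -> conn_packing ns -> conn_packing ns'.
Proof.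
apply: lengthening_closed => {ns ns'} [ns ns' p|n ns] [rs [bs [P C]]].
  by exists rs, bs; split=> //; exact: packs_perm P.
have [rs' [bs' [P' C' _]]] := lengthen P.
by exists rs', bs'; split=> //; exact: C'.
Qed.

Lemma K4_free_packing_le ns ns' :
  all2 leq ns ns' -> K4_free_packing ns -> K4_free_packing ns'.
Proof.
apply: lengthening_closed => {ns ns'} [ns ns' p|n ns] [rs [bs [P C]]].
  by exists rs, bs; split=> //; exact: packs_perm P.
have [rs' [bs' [P' _ C']]] := lengthen P.
by exists rs', bs'; split=> //; exact: C'.
Qed.

Lemma K4_packing_ge9 ns n : 8 < n -> K4_packing (9 :: ns) -> K4_packing (n :: ns).
Proof.
move=> n9 K9; rewrite -(subnK n9); elim: (n - 9) => // k [rs [bs [P [f hf]]]].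
have [rs' [bs' [P' hf']]] := lengthen_clique (leq_addl k 9) P hf.
by exists rs', bs'; split=> //; exists f.
Qed.

(** Induction from 3 C_3, strengthened by the non-adjacent pair that [add_triangle] consumes and
    reproduces. *)
Lemma conn_packing_triangles k : 2 < k -> conn_packing (nseq k 3).
Proof.
move=> k3; suff [rs [bs [P C _]]] : exists rs bs, [/\ packs (nseq k 3) rs bs,
    connected (uadj rs bs) (flatten rs) &
    exists f p, [/\ f \in flatten rs, p \in flatten rs, f != p & ~~ uadj rs bs f p]].
  by exists rs, bs.
rewrite -(subnK k3); elim: (k - 3) => [|j [rs [bs [P C [f [p [fV pV fp nfp]]]]]]].
  exists (blocks [:: 3; 3; 3]), [:: [:: 2; 4; 8]; [:: 0; 7; 5]; [:: 1; 6; 3]].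
  split; [by vm_compute|by apply: reachP; vm_compute|by exists 0, 3].
have [rs' [bs' [P' C' h]]] := add_triangle P fV pV fp nfp C.
by exists rs', bs'.
Qed.

Definition emb_type ns :=
  [&& 0 < size ns, all (leq 3) ns & ns \notin [:: [:: 3]; [:: 4]; [:: 3; 3]]].

(** Each such type dominates entrywise one of 5, (4, 3), (3, 4), or at least three entries 3. *)
Lemma emb_type_conn ns : emb_type ns -> conn_packing ns.
Proof.
case/and3P; case: ns => [|a [|b [|c ns]]] // _ a3.
- move=> h; apply: (@conn_packing_le [:: 5]).
    by move: a3 h; rewrite /= !andbT; case: a => [|[|[|[|[|a]]]]].
  exists (blocks [:: 5]), [:: [:: 0; 2; 4; 1; 3]].
  by split; [vm_compute|apply: reachP; vm_compute].
- have K : conn_packing [:: 4; 3].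
    exists (blocks [:: 4; 3]), [:: [:: 6; 1; 5; 3]; [:: 0; 4; 2]].
    by split; [vm_compute|apply: reachP; vm_compute].
  (* Both orders are used because [conn_packing_le] compares entries position by position. *)
  have K' : conn_packing [:: 3; 4].
    by have [rs [bs [P C]]] := K; exists rs, bs; split=> //; exact: packs_perm P.
  move=> h; have [a4|a4] := leqP 4 a.
    by apply: conn_packing_le K; move: a3; rewrite /= a4 => /and3P [_ ->].
  apply: conn_packing_le K'; move: a3 a4 h => /= /and3P [].
  by case: a => [|[|[|[|a]]]] //=; case: b => [|[|[|[|b]]]].
move=> _; apply: (@conn_packing_le (nseq (size [:: a, b, c & ns]) 3)).
  by elim: [:: a, b, c & ns] a3 => //= d s IH /andP [-> /IH].
exact: conn_packing_triangles.
Qed.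

(** * Packings with a K4 and packings without one *)

Definition K4_check ns bs f :=
  [&& packs ns (blocks ns) bs, size f == 4, uniq f, all (mem (flatten (blocks ns))) f &
      allrel (fun p q => (p != q) ==> uadj (blocks ns) bs p q) f f].

Lemma K4_checkP ns bs f : K4_check ns bs f -> K4_packing ns.
Proof.
case/and5P=> P /eqP sf uf /allP sub /allrelP h.
exists (blocks ns), bs; split=> //; exists f; split=> // p q hp hq.
by apply/implyP; exact: h.
Qed.

(* The explicit packings below were found by computer search. *)
Lemma K4_packing_1 n : 7 < n -> K4_packing [:: n].
Proof.
(* [lengthen_clique] applies from length 9 on, so a packing at length 9 starts the infinite family
   and shorter lengths get their own. *)
move=> h; have [/K4_packing_ge9|h9] := ltnP 8 n.
  apply; apply: (@K4_checkP _ [:: [:: 0; 4; 1; 3; 7; 5; 8; 6; 2]] [:: 5; 6; 7; 8]).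
  by vm_compute.
have -> : n = 8 by apply/eqP; rewrite eqn_leq h9.
by apply: (@K4_checkP _ [:: [:: 7; 4; 6; 1; 3; 0; 2; 5]] [:: 0; 1; 2; 3]); vm_compute.
Qed.

Lemma K4_packing_3 n : 6 < n -> K4_packing [:: n; 3].
Proof.
move=> h; have [/K4_packing_ge9|] := ltnP 8 n.
  apply; apply: (@K4_checkP _ [:: [:: 8; 10; 7; 11; 0; 3; 5; 2; 4]; [:: 9; 6; 1]] [:: 2; 3; 4; 5]).
  by vm_compute.
move: h; do 7 case: n => // n; case: n => [_ _|[_ _|//]].
  by apply: (@K4_checkP _ [:: [:: 9; 6; 7; 2; 4; 1; 3]; [:: 0; 5; 8]] [:: 1; 2; 3; 4]); vm_compute.
by apply: (@K4_checkP _ [:: [:: 5; 1; 7; 2; 0; 10; 4; 9]; [:: 8; 6; 3]] [:: 0; 1; 2; 7]); vm_compute.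
Qed.

Lemma K4_packing_4 n : 3 < n -> K4_packing [:: n; 4].
Proof.
move=> h; have [/K4_packing_ge9|] := ltnP 8 n.
  apply; apply: (@K4_checkP _ [:: [:: 2; 6; 0; 7; 3; 8; 4; 10; 12]; [:: 1; 9; 11; 5]] [:: 9; 10; 11; 12]).
  by vm_compute.
move: h; do 4 case: n => // n; case: n => [_ _|[_ _|[_ _|[_ _|[_ _|//]]]]].
- by apply: (@K4_checkP _ [:: [:: 6; 4; 2; 0]; [:: 7; 1; 3; 5]] [:: 0; 1; 2; 3]); vm_compute.
- by apply: (@K4_checkP _ [:: [:: 7; 5; 1; 3; 0]; [:: 4; 6; 8; 2]] [:: 5; 6; 7; 8]); vm_compute.
- by apply: (@K4_checkP _ [:: [:: 8; 0; 2; 5; 7; 1]; [:: 6; 3; 9; 4]] [:: 3; 4; 6; 9]); vm_compute.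
- by apply: (@K4_checkP _ [:: [:: 6; 3; 0; 5; 1; 8; 10]; [:: 4; 9; 7; 2]] [:: 7; 8; 9; 10]); vm_compute.
by apply: (@K4_checkP _ [:: [:: 8; 10; 3; 9; 11; 7; 5; 1]; [:: 6; 2; 0; 4]] [:: 8; 9; 10; 11]); vm_compute.
Qed.

(** Length 5 is settled later by means of the prism. *)
Lemma K4_packing_33 n : 3 < n -> n != 5 -> K4_packing [:: n; 3; 3].
Proof.
move=> h; have [/K4_packing_ge9 K _|] := ltnP 8 n.
  apply: K; apply: (@K4_checkP _ [:: [:: 3; 1; 4; 2; 0; 14; 8; 11; 5]; [:: 10; 6; 13]; [:: 7; 9; 12]] [:: 1; 2; 3; 4]).
  by vm_compute.
move: h; do 4 case: n => // n; case: n => [_ _|[_ _|[_ _|[_ _|[_ _|//]]]]] // _.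
- by apply: (@K4_checkP _ [:: [:: 4; 9; 5; 7]; [:: 6; 2; 0]; [:: 1; 3; 8]] [:: 0; 1; 2; 3]); vm_compute.
- by apply: (@K4_checkP _ [:: [:: 2; 11; 8; 3; 1; 4]; [:: 6; 10; 0]; [:: 9; 7; 5]] [:: 1; 2; 3; 4]); vm_compute.
- by apply: (@K4_checkP _ [:: [:: 5; 1; 6; 12; 9; 4; 0]; [:: 2; 10; 7]; [:: 11; 3; 8]] [:: 0; 1; 5; 6]); vm_compute.
by apply: (@K4_checkP _ [:: [:: 4; 1; 3; 0; 6; 10; 13; 2]; [:: 7; 12; 9]; [:: 8; 11; 5]] [:: 1; 2; 3; 4]); vm_compute.
Qed.

Lemma K4_packing_443 : K4_packing [:: 4; 4; 3].
Proof.
by apply: (@K4_checkP _ [:: [:: 4; 6; 3; 8]; [:: 7; 5; 1; 9]; [:: 10; 2; 0]] [:: 4; 5; 6; 7]); vm_compute.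
Qed.

Lemma K4_packing_444 : K4_packing [:: 4; 4; 4].
Proof.
by apply: (@K4_checkP _ [:: [:: 4; 0; 2; 6]; [:: 11; 9; 1; 3]; [:: 5; 7; 10; 8]] [:: 0; 1; 2; 3]); vm_compute.
Qed.

Lemma K4_packing_4333 : K4_packing [:: 4; 3; 3; 3].
Proof.
by apply: (@K4_checkP _ [:: [:: 12; 2; 11; 1]; [:: 5; 7; 3]; [:: 9; 4; 10]; [:: 8; 0; 6]] [:: 1; 2; 11; 12]); vm_compute.
Qed.

(** Starting types for [K4_free_packing_le], one for each number of cycles. A single cycle starts at
    6 because the packing of C_5 is K_5. *)
Lemma K4_free_packing_base ns : ns \in [:: [:: 6]; [:: 4; 3]; [:: 3; 3; 3]; [:: 4; 3; 3; 3]] ->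
  K4_free_packing ns.
Proof.
rewrite !inE => /or4P [] /eqP ->.
- exists (blocks [:: 6]), [:: [:: 5; 2; 0; 4; 1; 3]].
  by split; [vm_compute|apply: K4_free_avoids; vm_compute].
- exists (blocks [:: 4; 3]), [:: [:: 6; 1; 5; 3]; [:: 0; 4; 2]].
  by split; [vm_compute|apply: K4_free_avoids; vm_compute].
- exists (blocks [:: 3; 3; 3]), [:: [:: 2; 4; 8]; [:: 0; 7; 5]; [:: 1; 6; 3]].
  by split; [vm_compute|apply: K4_free_avoids; vm_compute].
exists (blocks [:: 4; 3; 3; 3]), [:: [:: 3; 10; 7; 5]; [:: 12; 2; 6]; [:: 9; 1; 4]; [:: 8; 11; 0]].
by split; [vm_compute|apply: K4_free_avoids; vm_compute].
Qed.

(** * From label packings to embeddings *)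

Lemma nth_cyc_edges (c : seq nat) i j : uniq c -> i < size c -> j < size c ->
  ((nth 0 c i, nth 0 c j) \in cyc_edges c) = (i.+1 %% size c == j).
Proof.
move=> u hi hj; have sz : size c = size (rot 1 c) by rewrite size_rot.
have nr k : k < size c -> nth 0 (rot 1 c) k = nth 0 c (k.+1 %% size c).
  case: (c) => // x t; rewrite rot1_cons /= ltnS nth_rcons => kt.
  have [k1|k1] := ltnP k (size t); first by rewrite modn_small.
  have -> : k = size t by apply/eqP; rewrite eqn_leq kt.
  by rewrite modnn eqxx.
have lm k : k.+1 %% size c < size c by rewrite ltn_mod (leq_ltn_trans _ hi).
have nz k : k < size c -> nth (0, 0) (cyc_edges c) k = (nth 0 c k, nth 0 c (k.+1 %% size c)).
  by move=> hk; rewrite nth_zip // nr.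
have sE : size (cyc_edges c) = size c by rewrite size_zip -sz minnn.
apply/idP/eqP=> [|<-].
  case/(nthP (0, 0))=> k; rewrite sE => hk; rewrite nz // => -[e1 e2].
  have <- : k = i by apply/eqP; rewrite -(nth_uniq 0 hk hi u) e1.
  by apply/eqP; rewrite -(nth_uniq 0 _ hj u) ?e2.
by rewrite -nz //; apply: mem_nth; rewrite sE.
Qed.

Lemma ladj_cons c cs x y :
  ladj (c :: cs) x y = ladj [:: c] x y || ladj cs x y.
Proof. by rewrite -cat1s ladj_cat. Qed.

Lemma cycle_label c : uniq c -> 2 < size c -> forall i j : cycle_graph (size c),
  adj i j = ladj [:: c] (nth 0 c i) (nth 0 c j).
Proof.
move=> u c3 i j; rewrite /ladj /edges /= cats0 !nth_cyc_edges //=.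
rewrite /cycle_adj -!val_eqE /=; have [e|//] := eqVneq (nat_of_ord i) j.
rewrite -e orbb; apply/esym/negbTE; have [h|h] := ltnP i.+1 (size c).
  by rewrite modn_small // gtn_eqF.
have -> : i.+1 = size c by apply/eqP; rewrite eqn_leq h ltn_ord.
by rewrite modnn eq_sym -lt0n -ltnS (leq_trans (ltnW c3)).
Qed.

(** An isomorphism of [G] onto the graph that [u] induces on [V]. Numbers as labels give graphs with
    different vertex types a common codomain. *)
Definition labelling (G : sgraph) (V : seq nat) (u : rel nat) (f : G -> nat) :=
  [/\ injective f, forall x, f x \in V,
    forall y, y \in V -> exists x, f x = y
  & forall x y, adj x y = u (f x) (f y)].

Lemma cycles_label cs : uniq (flatten cs) -> all (leq 3) (shape cs) ->
  exists f : cycles (shape cs) -> nat, labelling (flatten cs) (ladj cs) f.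
Proof.
elim: cs => [|c cs IH] /=.
  by move=> _ _; exists (fun v : void => match v with end); split; case.
rewrite cat_uniq => /and3P [uc /hasPn dis us] /andP [c3 a3].
have [f [fi fin fsur fadj]] := IH us a3.
have nin (i : 'I_(size c)) x : nth 0 c i = f x -> False.
  by move=> e; have := dis _ (fin x); rewrite /= -e mem_nth.
exists (fun x => match x with inl i => nth 0 c (nat_of_ord i) | inr y => f y end).
split.
- move=> [i|x] [j|y] //= e.
  + by congr inl; apply: val_inj; apply/eqP; rewrite /= -(nth_uniq 0 _ _ uc) ?e.
  + by have := nin _ _ e.
  + by have := nin _ _ (esym e).
  + by rewrite (fi _ _ e).
- by move=> [i|x]; rewrite mem_cat ?mem_nth // fin orbT.
- move=> y; rewrite mem_cat => /orP [yc|/fsur [x <-]]; last by exists (inr x).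
  have h : index y c < size c by rewrite index_mem.
  by exists (inl (Ordinal h)); rewrite /= nth_index.
have nc p q : p \in flatten cs -> ladj [:: c] p q = false.
  move=> h; apply/negbTE/negP=> /mem_ladj /andP []; rewrite /= cats0 => k _.
  by have := dis _ h; rewrite /= k.
have nf p q : p \in c -> ladj cs p q = false.
  move=> h; apply/negbTE/negP=> /mem_ladj /andP [k _].
  by have := dis _ k; rewrite /= h.
move=> [i|x] [j|y]; rewrite ladj_cons /=.
- by rewrite -cycle_label // nf ?mem_nth ?orbF.
- by rewrite nf ?mem_nth // ladj_sym nc.
- by rewrite nc // ladj_sym nf ?mem_nth.
- by rewrite nc // fadj.
Qed.

Lemma perm_shape (cs : seq (seq nat)) ns : perm_eq (shape cs) ns ->
  exists2 cs', perm_eq cs cs' & shape cs' = ns.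
Proof.
rewrite perm_sym => /(perm_iotaP 0) [Is pI ->].
exists [seq nth [::] cs i | i <- Is].
  by rewrite perm_sym; apply/(perm_iotaP [::]); exists Is; rewrite // -(size_map size).
rewrite /shape -map_comp; apply/eq_in_map => i; rewrite (perm_mem pI) mem_iota size_map /= => hi.
by rewrite (nth_map [::]).
Qed.

Lemma iso_labelling G ns cs : isomorphic G (cycles ns) -> uniq (flatten cs) ->
  all (leq 3) ns -> perm_eq (shape cs) ns -> 
  exists f : G -> nat, labelling (flatten cs) (ladj cs) f.
Proof.
move=> [phi [phi' pK Kp] padj] u a3 /perm_shape [cs' p e].
have pf := perm_flatten p; rewrite (perm_uniq pf) in u.
rewrite -e in a3 phi phi' pK Kp padj *.
have [f [fi fin fsur fadj]] := cycles_label u a3.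
exists (f \o phi); split=> [||y|x y].
- by apply: inj_comp => //; exact: can_inj pK.
- by move=> x; rewrite (perm_mem pf) fin.
- by rewrite (perm_mem pf) => /fsur [x <-]; exists (phi' x); rewrite /= Kp.
- by rewrite -padj fadj; apply/esym/ladj_perm/edges_perm.
Qed.

(** With [r] and [b] the labellings of [G] by the red and by the blue cycles, [s] is [b] followed by
    the inverse of [r]; read through [r], the graph s(G) is the blue copy. *)
Lemma realize G ns rs bs : isomorphic G (cycles ns) -> packs ns rs bs ->
  exists s : {perm G}, embedding s /\
    exists h : oplus s -> nat, labelling (flatten rs) (uadj rs bs) h.
Proof.
move=> iso P; have D := packs_disj P; have /and5P [a3 ps pb u /andP [pf _]] := P.
have [r [ri rin rsur radj]] := iso_labelling iso u a3 ps.
have ub : uniq (flatten bs) by rewrite -(perm_uniq pf).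
have [b [bi bin bsur badj]] := iso_labelling iso ub a3 pb.
(* [t] is the inverse of [s]; the default [x] is never returned, as [b] is onto the same labels. *)
pose t x := odflt x [pick y | b y == r x].
have tE x : b (t x) = r x.
  rewrite /t; case: pickP => [y /eqP //|no].
  have [|y e] := bsur (r x); first by rewrite -(perm_mem pf).
  by have := no y; rewrite e eqxx.
have ti : injective t by move=> x y e; apply: ri; rewrite -!tE e.
pose s : {perm G} := ((perm ti)^-1)%g.
have sE x : (s^-1)%g x = t x by rewrite invgK permE.
exists s; split.
  move=> x y; rewrite -{1}(permK s x) -{1}(permK s y) !sE badj !tE => h.
  by rewrite radj; apply/negP=> /D; rewrite h.
exists r; split=> // x y.
by rewrite /= /oplus_adj /image_adj !sE radj badj !tE.
Qed.

Definition label_iso (V1 V2 : seq nat) (u1 u2 : rel nat) (g : nat -> nat) :=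
  [/\ {in V1, forall x, g x \in V2}, {in V1 &, injective g},
      forall y, y \in V2 -> exists2 x, x \in V1 & g x = y
    & {in V1 &, forall x y, u2 (g x) (g y) = u1 x y}].

Lemma distinct_packings G ns rs1 bs1 rs2 bs2 : isomorphic G (cycles ns) ->
  packs ns rs1 bs1 -> packs ns rs2 bs2 ->
  (forall g, ~ label_iso (flatten rs1) (flatten rs2) (uadj rs1 bs1) (uadj rs2 bs2) g) ->
  exists s1 s2 : {perm G}, distinct_embeddings s1 s2.
Proof.
move=> iso P1 P2 no.
have [s1 [E1 [h1 [i1 in1 su1 a1]]]] := realize iso P1.
have [s2 [E2 [h2 [i2 in2 su2 a2]]]] := realize iso P2.
exists s1, s2; split=> // -[psi [psi' pK Kp] padj].
pose g y := if [pick x | h1 x == y] is Some x then h2 (psi x) else 0.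
have gE x : g (h1 x) = h2 (psi x).
  rewrite /g; case: pickP => [z /eqP /i1 -> //|/(_ x)]; by rewrite eqxx.
apply: (no g); split.
- by move=> _ /su1 [x <-]; rewrite gE.
- by move=> _ _ /su1 [x <-] /su1 [y <-]; rewrite !gE => /i2 /(can_inj pK) ->.
- move=> _ /su2 [y <-]; exists (h1 (psi' y)) => //; by rewrite gE Kp.
by move=> _ _ /su1 [x <-] /su1 [y <-]; rewrite !gE -a2 padj a1.
Qed.

Lemma clique4_iso V1 V2 u1 u2 g f : label_iso V1 V2 u1 u2 g ->
  clique4 u1 V1 f -> clique4 u2 V2 (map g f).
Proof.
move=> [gin gi _ gu] [sf uf sub h]; split.
- by rewrite size_map.
- by rewrite map_inj_in_uniq // => x y /sub hx /sub hy; exact: gi.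
- by move=> _ /mapP [x hx ->]; apply: gin; exact: sub.
move=> _ _ /mapP [x hx ->] /mapP [y hy ->] gxy.
by rewrite gu ?sub // h //; apply: contraNneq gxy => ->.
Qed.

Lemma contains_iso V1 V2 u1 u2 g m H f : all (fun e => (e.1 < m) && (e.2 < m)) H ->
  label_iso V1 V2 u1 u2 g -> contains u1 V1 m H f -> contains u2 V2 m H (map g f).
Proof.
move=> /allP Hm [gin gi _ gu] [sf uf sub h]; split.
- by rewrite size_map.
- by rewrite map_inj_in_uniq // => x y /sub hx /sub hy; exact: gi.
- by move=> _ /mapP [x hx ->]; apply: gin; exact: sub.
move=> e eH; have /andP [l1 l2] := Hm e eH.
by rewrite !(nth_map 0) ?sf // gu ?h // sub // mem_nth ?sf.
Qed.

Lemma connected_iso V1 V2 (u1 u2 : rel nat) g : (forall x y, u2 x y -> (x \in V2) && (y \in V2)) ->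
  label_iso V1 V2 u1 u2 g -> (forall x y, u1 x y -> (x \in V1) && (y \in V1)) ->
  connected u1 V1 -> connected u2 V2.
Proof.
move=> m2 [gin gi gs gu] m1 C A hA _ _ /gs [x xV <-] /gs [y yV <-].
apply: (C (A \o g)) => // a b h; have /andP [ha hb] := m1 _ _ h.
by apply: hA; rewrite gu.
Qed.

Lemma distinct_K4 G ns : isomorphic G (cycles ns) -> K4_packing ns ->
  K4_free_packing ns -> exists s1 s2 : {perm G}, distinct_embeddings s1 s2.
Proof.
move=> iso [r1 [b1 [P1 [f hf]]]] [r2 [b2 [P2 free]]].
apply: (distinct_packings iso P1 P2) => g hg; exact: free (clique4_iso hg hf).
Qed.

(** A connected packing of the whole type is compared with packings of the two parts placed side by
    side. *)
Lemma distinct_split G ns1 ns2 : isomorphic G (cycles (ns1 ++ ns2)) ->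
  emb_type ns1 -> emb_type ns2 -> emb_type (ns1 ++ ns2) ->
  exists s1 s2 : {perm G}, distinct_embeddings s1 s2.
Proof.
move=> iso e1 e2 /emb_type_conn [r1 [b1 [P1 C]]].
have [rs1 [bs1 [Q1 _]]] := emb_type_conn e1; have [rs2 [bs2 [Q2 _]]] := emb_type_conn e2.
have [n1 n2] : 0 < size ns1 /\ 0 < size ns2 by case/and3P: e1; case/and3P: e2.
have [r2 [b2 [P2 nC]]] := packs_union n1 n2 Q1 Q2.
apply: (distinct_packings iso P1 P2) => g hg; apply: nC.
by apply: connected_iso hg _ C => x y; [exact: mem_uadj P2|exact: mem_uadj P1].
Qed.

Lemma distinct_prism G ns bs1 bs2 f : isomorphic G (cycles ns) ->
  packs ns (blocks ns) bs1 -> packs ns (blocks ns) bs2 ->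
  contains (uadj (blocks ns) bs1) (flatten (blocks ns)) 6 prism_edges f ->
  avoids (uadj (blocks ns) bs2) (flatten (blocks ns)) 6 prism_edges ->
  exists s1 s2 : {perm G}, distinct_embeddings s1 s2.
Proof.
move=> iso P1 P2 c a; apply: (distinct_packings iso P1 P2) => g hg.
by apply: avoidsP a _ => //; apply: contains_iso hg c.
Qed.

(** * Cycle types with two distinct embeddings *)

Lemma labelling_iso (G H : sgraph) V u f g :
  @labelling G V u f -> @labelling H V u g -> isomorphic G H.
Proof.
move=> [fi fin fs fa] [gi gin gs ga].
(* Matching vertices with equal labels, once in each direction, yields mutually inverse maps. *)
have E (A B : sgraph) (a : A -> nat) (b : B -> nat) : @labelling A V u a -> @labelling B V u b ->
    exists h : A -> B, forall x, b (h x) = a x.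
  move=> [_ ain _ _] [_ _ bs _].
  have F x : exists y, b y == a x by have [y e] := bs _ (ain x); exists y; rewrite e.
  by exists (fun x => xchoose (F x)) => x; apply/eqP; exact: (xchooseP (F x)).
have [h hE] := E G H f g (And4 fi fin fs fa) (And4 gi gin gs ga).
have [k kE] := E H G g f (And4 gi gin gs ga) (And4 fi fin fs fa).
exists h; last by move=> x y; rewrite ga fa !hE.
by exists k => x; [apply: fi; rewrite kE hE|apply: gi; rewrite hE kE].
Qed.

Lemma isomorphic_refl G : isomorphic G G.
Proof. by exists id => //; exists id. Qed.

Lemma isomorphic_trans G H K : isomorphic G H -> isomorphic H K -> isomorphic G K.
Proof.
move=> [f bf af] [g bg ag]; exists (g \o f); first exact: bij_comp.
by move=> x y; rewrite /= ag af.
Qed.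

Lemma shape_blocks ns : shape (blocks ns) = ns.
Proof. by apply: reshapeKl; rewrite size_iota. Qed.

Lemma flatten_blocks ns : flatten (blocks ns) = iota 0 (sumn ns).
Proof. by apply: reshapeKr; rewrite size_iota. Qed.

Lemma blocks_labelling G ns ns' : isomorphic G (cycles ns) -> all (leq 3) ns ->
  perm_eq ns' ns -> 
  exists f : G -> nat, labelling (flatten (blocks ns')) (ladj (blocks ns')) f.
Proof.
move=> iso a3 p; apply: iso_labelling iso _ a3 _; first by rewrite flatten_blocks iota_uniq.
by rewrite shape_blocks.
Qed.

(** Both graphs are labelled by [blocks ns], so the summands need not be rearranged by hand. *)
Lemma isomorphic_perm G ns ns' : isomorphic G (cycles ns) -> all (leq 3) ns ->
  perm_eq ns ns' -> isomorphic G (cycles ns').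
Proof.
move=> iso a3 p; have [f hf] := blocks_labelling iso a3 (perm_refl _).
rewrite (perm_all _ p) in a3.
have [g hg] := blocks_labelling (isomorphic_refl (cycles ns')) a3 p.
exact: labelling_iso hf hg.
Qed.

Lemma emb_type1 a : 4 < a -> emb_type [:: a].
Proof. by case: a => [|[|[|[|[|a]]]]]. Qed.

Lemma emb_type2 a b : 2 < a -> 3 < b -> emb_type [:: a; b].
Proof.
by rewrite /emb_type /= => -> h; case: b h => [|[|[|[|b]]]] // _; rewrite !inE !eqseq_cons !andbF.
Qed.

Lemma emb_type3 ns : 2 < size ns -> all (leq 3) ns -> emb_type ns.
Proof.
by case: ns => [|a [|b [|c ns]]] // _ h; rewrite /emb_type h !inE !eqseq_cons !andbF.
Qed.

(** Sorted cycle lengths of the nine graphs that the theorem names. *)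
Definition exceptions : seq (seq nat) :=
  [:: [:: 3]; [:: 4]; [:: 3; 3]; [:: 5]; [:: 6]; [:: 3; 4]; [:: 3; 5];
      [:: 3; 3; 3]; [:: 3; 3; 3; 3]].

Definition prism_check ns bs1 f bs2 :=
  [&& packs ns (blocks ns) bs1 && packs ns (blocks ns) bs2,
      size f == 6, uniq f, all (mem (flatten (blocks ns))) f &
      all (fun e => uadj (blocks ns) bs1 (nth 0 f e.1) (nth 0 f e.2)) prism_edges &&
      avoids (uadj (blocks ns) bs2) (flatten (blocks ns)) 6 prism_edges].

Lemma prism_checkP G ns bs1 f bs2 : isomorphic G (cycles ns) ->
  prism_check ns bs1 f bs2 ->
  exists s1 s2 : {perm G}, distinct_embeddings s1 s2.
Proof.
move=> iso /and5P [/andP [P1 P2] /eqP sf uf /allP sub /andP [/allP c a]].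
by apply: (distinct_prism iso P1 P2 (f := f)) a; split.
Qed.

Lemma squeeze m n : m <= n -> n < m.+1 -> n = m.
Proof. by move=> h k; apply/eqP; rewrite eqn_leq h andbT -ltnS. Qed.

(** Case analysis on the number of cycles, the sorting keeping the cases few. A split into two
    embeddable parts is used where available, otherwise a K4 or a prism. Six or more cycles split
    into three and the rest. *)
Lemma two_embeddings G ns : isomorphic G (cycles ns) -> all (leq 3) ns ->
  0 < size ns -> sorted leq ns -> ns \notin exceptions ->
  exists s1 s2 : {perm G}, distinct_embeddings s1 s2.
Proof.
move=> iso a3 n0 srt ex.
have K4 ms base : perm_eq ns ms -> K4_packing ms ->
    base \in [:: [:: 6]; [:: 4; 3]; [:: 3; 3; 3]; [:: 4; 3; 3; 3]] ->
    all2 leq base ms -> exists s1 s2 : {perm G}, distinct_embeddings s1 s2.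
  move=> p K /K4_free_packing_base b le; apply: distinct_K4 K _.
    exact: isomorphic_perm iso a3 p.
  exact: K4_free_packing_le le b.
have split n1 n2 : perm_eq ns (n1 ++ n2) -> emb_type n1 -> emb_type n2 ->
    emb_type (n1 ++ n2) -> exists s1 s2 : {perm G}, distinct_embeddings s1 s2.
  by move=> p; apply: distinct_split; exact: isomorphic_perm iso a3 p.
case: ns n0 a3 srt ex iso K4 split => [//|a [|b [|c [|d [|e [|x r]]]]]] _.
- move=> al srt ex iso K4 split; move: (al) srt; rewrite /= ?andbT => a3 _.
  have a7 : 6 < a by move: a3 ex; case: (a) => [|[|[|[|[|[|[|a']]]]]]].
  have [a8|a7'] := leqP 8 a.
    by apply: (K4 [:: a] [:: 6]) => //; [exact: K4_packing_1|rewrite /= (ltnW a7)].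
  (* C_7: [bs1] gives a packing with a prism on [f], and an exhaustive search finds none in the
     packing given by [bs2]. *)
  rewrite (squeeze a7 a7') in iso; apply: (prism_checkP iso
    (bs1 := [:: [:: 2; 6; 3; 5; 1; 4; 0]]) (f := [:: 0; 1; 2; 4; 5; 3])
    (bs2 := [:: [:: 6; 3; 5; 2; 0; 4; 1]])).
  by vm_compute.
- move=> al srt ex iso K4 split; move: (al) srt; rewrite /= ?andbT => /andP [a3 b3] ab.
  have [a5|a5] := leqP 5 a.
    have b5 := leq_trans a5 ab.
    by apply: (split [:: a] [:: b]); rewrite ?emb_type1 // emb_type2 // (ltnW b5).
  have [a4|a4] := leqP 4 a.
    move: (squeeze a4 a5) => E; subst a; apply: (K4 [:: b; 4] [:: 4; 3]) => //.
    + exact: (permEl (perm_catC [:: 4] [:: b])).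
    + exact: K4_packing_4.
    + by rewrite /= ab.
  move: (squeeze a3 a4) => E; subst a.
  have p : perm_eq [:: 3; b] [:: b; 3] by exact: (permEl (perm_catC [:: 3] [:: b])).
  have b6 : 5 < b by move: b3 ex; case: (b) => [|[|[|[|[|[|b']]]]]].
  have [b7|b7] := leqP 7 b.
    apply: (K4 [:: b; 3] [:: 4; 3]) => //; first exact: K4_packing_3.
    by rewrite /= (leq_trans _ b6).
  move: (squeeze b6 b7) => E; subst b.
  apply: (prism_checkP (isomorphic_perm iso isT p)
    (bs1 := [:: [:: 2; 5; 3; 7; 0; 8]; [:: 6; 1; 4]])
    (f := [:: 0; 7; 8; 5; 3; 2])
    (bs2 := [:: [:: 0; 4; 7; 3; 8; 2]; [:: 5; 6; 1]])).
  by vm_compute.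
- move=> al srt ex iso K4 split; move: (al) srt; rewrite /= ?andbT => /and3P [a3 b3 c3] /andP [ab bc].
  have [b4|b4] := leqP 4 b; last first.
    move: (squeeze b3 b4) => E; subst b; move: (squeeze a3 ab) => E; subst a.
    have c4 : 3 < c by move: c3 ex; case: (c) => [|[|[|[|c']]]].
    have p : perm_eq [:: 3; 3; c] [:: c; 3; 3].
      exact: (permEl (perm_catC [:: 3; 3] [:: c])).
    have [c5|c5] := eqVneq c 5; last first.
      by apply: (K4 [:: c; 3; 3] [:: 3; 3; 3]) => //; exact: K4_packing_33.
    subst c; apply: (prism_checkP (isomorphic_perm iso isT p)
      (bs1 := [:: [:: 4; 2; 8; 5; 1]; [:: 7; 0; 10]; [:: 6; 3; 9]])
      (f := [:: 5; 6; 7; 8; 9; 10])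
      (bs2 := [:: [:: 9; 5; 10; 0; 2]; [:: 1; 7; 4]; [:: 8; 6; 3]])).
    by vm_compute.
  (* A cycle of length at least 5 is embeddable alone, and so are the other two together because [b]
     is at least 4. *)
  have [c5|c5] := leqP 5 c.
    apply: (split [:: a; b] [:: c]) => //; rewrite ?emb_type1 ?emb_type2 //.
    by apply: emb_type3 => //=; rewrite a3 b3 c3.
  move: (squeeze (leq_trans b4 bc) c5) => E; subst c.
  move: (squeeze b4 bc) => E; subst b.
  have [a4|a4] := leqP 4 a.
    move: (squeeze a4 ab) => E; subst a.
    by apply: (K4 [:: 4; 4; 4] [:: 3; 3; 3]) => //; exact: K4_packing_444.
  move: (squeeze a3 a4) => E; subst a.
  by apply: (K4 [:: 4; 4; 3] [:: 3; 3; 3]) => //; exact: K4_packing_443.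
- move=> al srt ex iso K4 split; move: (al) srt; rewrite /= ?andbT => /and4P [a3 b3 c3 d3] /and3P [ab bc cd].
  have [d5|d5] := leqP 5 d.
    apply: (split [:: a; b; c] [:: d]) => //; rewrite ?emb_type1 ?emb_type3 //=.
    by rewrite a3 b3 c3.
  (* If the two longest cycles are 4-cycles, one goes to each part, since two triangles alone would
     not be embeddable. *)
  have [c4|c4] := leqP 4 c.
    apply: (split [:: a; c] [:: b; d]).
    + by rewrite /= perm_cons (permEl (perm_catCA [:: b] [:: c] [:: d])).
    + by rewrite emb_type2.
    + by rewrite emb_type2 // (leq_trans c4).
    + by rewrite emb_type3 //= a3 b3 c3 d3.
  move: (squeeze c3 c4) => E; subst c; move: (squeeze b3 bc) => E; subst b.
  move: (squeeze a3 ab) => E; subst a.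
  have d4 : 3 < d by move: d3 ex; case: (d) => [|[|[|[|d']]]].
  move: (squeeze d4 d5) => E; subst d.
  by apply: (K4 [:: 4; 3; 3; 3] [:: 4; 3; 3; 3]) => //; exact: K4_packing_4333.
- move=> al srt ex iso K4 split; move: (al) srt; rewrite /= ?andbT => /and5P [a3 b3 c3 d3 e3] /and4P [ab bc cd de].
  have [e5|e5] := leqP 5 e.
    apply: (split [:: a; b; c; d] [:: e]) => //; rewrite ?emb_type1 ?emb_type3 //=.
    by rewrite a3 b3 c3 d3.
  have [e4|e4] := leqP 4 e.
    apply: (split [:: a; e] [:: b; c; d]).
    + by rewrite /= perm_cons (permEl (perm_catC [:: b; c; d] [:: e])).
    + by rewrite emb_type2.
    + by rewrite emb_type3 //= b3 c3 d3.
    + by rewrite emb_type3 //= a3 b3 c3 d3 e3.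
  move: (squeeze e3 e4) => E; subst e; move: (squeeze d3 de) => E; subst d.
  move: (squeeze c3 cd) => E; subst c; move: (squeeze b3 bc) => E; subst b.
  move: (squeeze a3 ab) => E; subst a.
  apply: (prism_checkP iso
    (bs1 := [:: [:: 13; 8; 0]; [:: 12; 9; 1]; [:: 7; 3; 11]; [:: 10; 6; 5]; [:: 2; 14; 4]])
    (f := [:: 0; 1; 2; 13; 12; 14])
    (bs2 := [:: [:: 2; 3; 11]; [:: 6; 14; 9]; [:: 4; 7; 13]; [:: 5; 1; 8]; [:: 12; 10; 0]])).
  by vm_compute.
move=> al _ _ iso _ split.
have /andP [h1 h2] : all (leq 3) [:: a; b; c] && all (leq 3) [:: d, e, x & r].
  by rewrite -all_cat.
by apply: (split [:: a; b; c] [:: d, e, x & r]) => //; exact: emb_type3.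
Qed.

Lemma iso_cycles1 n : isomorphic (cycles [:: n]) (cycle_graph n).
Proof.
exists (fun x : 'I_n + void => match x with inl i => i | inr v => of_void _ v end).
  by exists inl => [[i|[]]|i].
by move=> [i|[]] [j|[]].
Qed.

Lemma iso_cycles2 m n :
  isomorphic (cycles [:: m; n]) (disjoint_union (cycle_graph m) (cycle_graph n)).
Proof.
exists (fun x : 'I_m + ('I_n + void) => match x with inl i => inl i
  | inr (inl j) => inr j | inr (inr v) => of_void _ v end).
  exists (fun x => match x with inl i => inl i | inr j => inr (inl j) end).
    by move=> [i|[j|[]]].
  by move=> [i|j].
by move=> [i|[i|[]]] [j|[j|[]]].
Qed.

Lemma exceptions_excluded G ns : isomorphic G (cycles ns) ->
  List.Forall (fun H : sgraph => ~ isomorphic G H)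
    (not_embeddable_list ++ uniquely_embeddable_list) ->
  ns \notin exceptions.
Proof.
move=> iso; have i1 n : ns = [:: n] -> isomorphic G (cycle_graph n).
  by move=> E; rewrite E in iso; exact: isomorphic_trans iso (iso_cycles1 n).
have i2 m n : ns = [:: m; n] ->
    isomorphic G (disjoint_union (cycle_graph m) (cycle_graph n)).
  by move=> E; rewrite E in iso; exact: isomorphic_trans iso (iso_cycles2 m n).
have ik k : ns = nseq k 3 -> isomorphic G (copies k (cycle_graph 3)).
  move=> E; rewrite E in iso; have -> : copies k (cycle_graph 3) = cycles (nseq k 3).
    by elim: k {E iso} => //= k ->.
  exact: iso.
do 9 (move/List.Forall_cons_iff; case=> ?); move=> _.
rewrite !inE; apply/negP.
by do 8 (case/predU1P=> [E|]; first by [have := i1 _ E|have := i2 _ _ E|have := ik 2 E|have := ik 3 E]);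
  move/eqP=> E; have := ik 4 E.
Qed.

Lemma union_of_cycles_two G : union_of_cycles G ->
  List.Forall (fun H : sgraph => ~ isomorphic G H)
    (not_embeddable_list ++ uniquely_embeddable_list) ->
  exists s1 s2 : {perm G}, distinct_embeddings s1 s2.
Proof.
move=> [ns [n0 a3 iso]] no.
have p : perm_eq ns (sort leq ns) by rewrite perm_sym perm_sort.
have iso' := isomorphic_perm iso a3 p.
apply: (two_embeddings iso'); rewrite ?size_sort ?all_sort //.
  exact: (sort_sorted leq_total).
exact: exceptions_excluded iso' no.
Qed.

(** * Unions of three and four triangles *)

(** An injection into a list no longer than the vertex set is onto, so surjectivity comes from
    counting. *)
Lemma labelling_card (G : sgraph) (V : seq nat) (u : rel nat) (f : G -> nat) :
  injective f -> (forall x, f x \in V) -> size V <= #|G| ->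
  (forall x y, adj x y = u (f x) (f y)) -> labelling V u f.
Proof.
move=> fi fin sV fadj; split=> // y yV.
have ui : uniq [seq f x | x <- enum G] by rewrite map_inj_uniq // enum_uniq.
have sub : {subset [seq f x | x <- enum G] <= V} by move=> _ /mapP [x _ ->].
have [|_ E] := uniq_min_size ui sub; first by rewrite size_map -cardE.
by move: yV; rewrite -E => /mapP [x _ ->]; exists x.
Qed.

Lemma card_triangles k : #|cycles (nseq k 3)| = 3 * k.
Proof.
elim: k => [|k IH]; first by rewrite card_void.
by rewrite /= card_sum card_ord IH mulnS.
Qed.

(** A triangle is complete, so numbering the triangles by [r] turns adjacency into equality of
    classes between distinct vertices. *)
Lemma triangle_classes k : exists r : cycles (nseq k 3) -> 'I_k,
  (forall x y, adj x y = (x != y) && (r x == r y)) /\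
  forall i, #|[set x | r x == i]| = 3.
Proof.
elim: k => [|k [r [radj rcard]]]; first by exists (of_void _); split; case.
pose r' (x : 'I_3 + cycles (nseq k 3)) : 'I_k.+1 :=
  match x with inl _ => ord0 | inr y => lift ord0 (r y) end.
exists r'; split.
- move=> [i|x] [j|y] /=.
  + rewrite eqxx andbT (inj_eq (@inl_inj _ _)) /cycle_adj andbC.
    by case: i => [[|[|[|i]]] hi] //; case: j => [[|[|[|j]]] hj].
  + by rewrite /r' (negbTE (neq_lift _ _)) ?andbF.
  + by rewrite /r' eq_sym (negbTE (neq_lift _ _)) ?andbF.
  + by rewrite radj /r' (inj_eq lift_inj).
move=> i; have [j ->|->] := unliftP ord0 i.
  transitivity #|[set (inr y : 'I_3 + cycles (nseq k 3)) | y in [set x | r x == j]]|; last first.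
    by rewrite card_imset ?rcard //; exact: inr_inj.
  apply: eq_card => -[x|x]; rewrite inE /r'.
    by rewrite (negbTE (neq_lift _ _)); apply/esym/negP=> /imsetP [].
  rewrite (inj_eq lift_inj); apply/idP/imsetP=> [h|[y h [->]]]; last by move: h; rewrite inE.
  by exists x; rewrite ?inE.
transitivity #|[set (inl x : 'I_3 + cycles (nseq k 3)) | x in 'I_3]|; last first.
  by rewrite card_imset ?card_ord //; exact: inl_inj.
apply: eq_card => -[x|x]; rewrite inE /r'.
  by rewrite eqxx; apply/esym/imsetP; exists x.
by rewrite eq_sym (negbTE (neq_lift _ _)); apply/esym/negP=> /imsetP [].
Qed.

Definition blue_class k (r : cycles (nseq k 3) -> 'I_k)
  (s : {perm cycles (nseq k 3)}) x := r ((s^-1)%g x).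

Lemma oplus_classes k (r : cycles (nseq k 3) -> 'I_k) s :
  (forall x y, adj x y = (x != y) && (r x == r y)) ->
  forall x y : oplus s, adj x y =
    (x != y) && ((r x == r y) || (blue_class r s x == blue_class r s y)).
Proof.
move=> radj x y.
by rewrite /= /oplus_adj /image_adj !radj (inj_eq perm_inj) -andb_orr.
Qed.

(** Two vertices sharing both triangles would be joined by a red and a blue edge. *)
Lemma classes_inj k (r : cycles (nseq k 3) -> 'I_k) s :
  (forall x y, adj x y = (x != y) && (r x == r y)) -> embedding s ->
  forall x y, r x = r y -> blue_class r s x = blue_class r s y -> x = y.
Proof.
rewrite /blue_class => radj emb x y e1 e2; apply/eqP/negPn/negP=> xy.
have := emb ((s^-1)%g x) ((s^-1)%g y).
by rewrite !permKV !radj (inj_eq perm_inj) xy e1 e2 !eqxx => /(_ isT).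
Qed.

Lemma card_blue_class k (r : cycles (nseq k 3) -> 'I_k) s :
  (forall i, #|[set x | r x == i]| = 3) ->
  forall j, #|[set x | blue_class r s x == j]| = 3.
Proof.
move=> rcard j; transitivity #|s @: [set x | r x == j]|; last first.
  by rewrite card_imset ?rcard //; exact: perm_inj.
apply: eq_card => x; rewrite inE; apply/idP/imsetP => [h|[y h ->]].
  by exists ((s^-1)%g x); rewrite ?inE ?permKV.
by move: h; rewrite inE /blue_class permK.
Qed.

(** The rook's graph of the m x m board, the cell in row i and column j being the number i m + j. *)
Definition grid_adj m : rel nat :=
  fun p q => (p != q) && ((p %/ m == q %/ m) || (p %% m == q %% m)).

Lemma grid_code m (a b c d : 'I_m) :
  [/\ (a * m + b == c * m + d :> nat) = (a == c) && (b == d),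
      ((a * m + b) %/ m == (c * m + d) %/ m) = (a == c)
    & ((a * m + b) %% m == (c * m + d) %% m) = (b == d)].
Proof.
have m0 : 0 < m by case: m a b c d => [[]|].
have e3 : ((a * m + b) %% m == (c * m + d) %% m) = (b == d).
  by rewrite !modnMDl !modn_small.
have e2 : ((a * m + b) %/ m == (c * m + d) %/ m) = (a == c).
  by rewrite !divnMDl // !divn_small // !addn0.
split=> //; apply/eqP/andP => [e|[/eqP -> /eqP ->] //].
by split; [rewrite -e2 e|rewrite -e3 e].
Qed.

(** The nine vertices occupy distinct cells, red triangle by blue triangle, and so fill the
    board. *)
Lemma three_triangles_labelling (s : {perm cycles (nseq 3 3)}) : embedding s ->
  exists f : oplus s -> nat, labelling (iota 0 9) (grid_adj 3) f.
Proof.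
move=> emb; have [r [radj rcard]] := triangle_classes 3.
pose b := blue_class r s; have inj := classes_inj radj emb.
exists (fun x => r x * 3 + b x); apply: labelling_card.
- move=> x y /eqP; have [-> _ _] := grid_code (r x) (b x) (r y) (b y).
  by case/andP=> /eqP e1 /eqP e2; exact: inj.
- move=> x; rewrite mem_iota /=; have := ltn_ord (r x); have := ltn_ord (b x).
  by case: (r x) => [[|[|[|p]]] ?] //; case: (b x) => [[|[|[|q]]] ?].
- by rewrite size_iota (card_triangles 3).
move=> x y; rewrite (oplus_classes radj) /grid_adj.
have [e1 -> ->] := grid_code (r x) (b x) (r y) (b y); rewrite e1.
have [->|xy] := eqVneq x y; first by rewrite !eqxx.
suff -> : (r x == r y) && (b x == b y) = false by [].
apply/negP=> /andP [/eqP h1 /eqP h2].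
by rewrite (inj _ _ h1 h2) eqxx in xy.
Qed.

Lemma cardC1_ex (T : finType) (A : {set T}) : #|T| = #|A|.+1 ->
  exists m, forall y, (y \in A) = (y != m).
Proof.
move=> e; have /eqP/cards1P [m hm] : #|~: A| = 1.
  by have := cardsC A; rewrite e -addn1 => /addnI.
by exists m => y; rewrite -[A]setCK hm !inE.
Qed.

(** A red triangle meets exactly three blue ones and conversely, so each row and each column of the
    board has one empty cell. Renumbering the columns by [m'] moves the empty cells to the
    diagonal. *)
Lemma four_triangles_labelling (s : {perm cycles (nseq 4 3)}) : embedding s ->
  exists f : oplus s -> nat,
    labelling [seq p <- iota 0 16 | p %/ 4 != p %% 4] (grid_adj 4) f.
Proof.
move=> emb; have [r [radj rcard]] := triangle_classes 4.
pose b := blue_class r s; have inj := classes_inj radj emb.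
have row i : exists m, forall j, (j \in b @: [set x | r x == i]) = (j != m).
  apply: cardC1_ex; rewrite card_ord card_in_imset ?rcard // => x y.
  by rewrite !inE => /eqP <- /eqP /esym; exact: inj.
have col j : exists m, forall i, (i \in r @: [set x | b x == j]) = (i != m).
  apply: cardC1_ex; rewrite card_ord card_in_imset ?(@card_blue_class _ _ s rcard) // => x y.
  by rewrite !inE => /eqP <- /eqP /esym h1 h2; exact: inj.
(* Boolean quantifiers, so that [xchoose] can select the empty cell. *)
have row' i : exists m, [forall j, (j \in b @: [set x | r x == i]) == (j != m)].
  by have [m h] := row i; exists m; apply/forallP=> j; rewrite h.
have col' j : exists m, [forall i, (i \in r @: [set x | b x == j]) == (i != m)].
  by have [m h] := col j; exists m; apply/forallP=> i; rewrite h.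
pose m i := xchoose (row' i); pose m' j := xchoose (col' j).
have mE i j : (j \in b @: [set x | r x == i]) = (j != m i).
  exact/eqP/(forallP (xchooseP (row' i))).
have m'E j i : (i \in r @: [set x | b x == j]) = (i != m' j).
  exact/eqP/(forallP (xchooseP (col' j))).
have swap i j : (j \in b @: [set x | r x == i]) = (i \in r @: [set x | b x == j]).
  by apply/imsetP/imsetP=> -[x]; rewrite inE => /eqP <- ->; exists x; rewrite ?inE.
have mK j : m (m' j) = j.
  by apply/esym/eqP/negPn; rewrite -mE swap m'E eqxx.
have m'i : injective m' := can_inj mK.
have off x : r x != m' (b x) by rewrite -m'E; apply/imsetP; exists x; rewrite ?inE.
exists (fun x => r x * 4 + m' (b x)); apply: labelling_card.
- move=> x y /eqP; have [-> _ _] := grid_code (r x) (m' (b x)) (r y) (m' (b y)).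
  by case/andP=> /eqP e1 /eqP /m'i e2; exact: inj.
- move=> x; have := off x; move: (r x) (m' (b x)).
  by case=> [[|[|[|[|p]]]] ?] //; case=> [[|[|[|[|q]]]] ?].
- by rewrite (card_triangles 4).
move=> x y; rewrite (oplus_classes radj) /grid_adj.
have [e1 -> ->] := grid_code (r x) (m' (b x)) (r y) (m' (b y)); rewrite e1 (inj_eq m'i).
have [->|xy] := eqVneq x y; first by rewrite !eqxx.
suff -> : (r x == r y) && (b x == b y) = false by [].
apply/negP=> /andP [/eqP h1 /eqP h2].
by rewrite (inj _ _ h1 h2) eqxx in xy.
Qed.

(** * Small cases by exhaustive search *)

(** [q] lists the values of the inverse of [s] on labels, so the second disjunct is adjacency in
    s(G). *)
Definition code_adj (a : rel nat) (q : seq nat) : rel nat :=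
  fun i j => a i j || a (nth 0 q i) (nth 0 q j).

(** The packing condition for the inverse of [s], equivalent to that for [s], tested between the new
    position and the earlier ones. *)
Definition code_ok (a : rel nat) (p : seq nat) (x : nat) :=
  if x \in p then false else
  lazy_all (fun j => if a j (size p) then ~~ a (nth 0 p j) x else true)
    (iota 0 (size p)).

(** Extends a partial isomorphism from [u] to [v]; loops are compared too, as these relations are
    not assumed irreflexive. *)
Definition iso_ok (u v : rel nat) (p : seq nat) (x : nat) :=
  if x \in p then false else
  if u (size p) (size p) == v x x then
    lazy_all (fun j => u j (size p) == v (nth 0 p j) x) (iota 0 (size p))
  else false.

Lemma embedding_code (G : sgraph) N a f (s : {perm G}) :
  @labelling G (iota 0 N) a f -> embedding s ->
  exists q, admissible (iota 0 N) (code_ok a) N [::] q /\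
    @labelling (oplus s) (iota 0 N) (code_adj a q) f.
Proof.
move=> [fi fin fs fadj] emb.
have fN x : f x < N by have := fin x; rewrite mem_iota.
pose g i := if [pick x | f x == i] is Some x then f ((s^-1)%g x) else 0.
have gE x : g (f x) = f ((s^-1)%g x).
  by rewrite /g; case: pickP => [y /eqP /fi -> //|/(_ x)]; rewrite eqxx.
have fsN i : i < N -> exists x, f x = i by move=> h; apply: fs; rewrite mem_iota.
have nq i : i < N -> nth 0 (mkseq g N) i = g i by exact: nth_mkseq.
exists (mkseq g N); split; last first.
  by split=> // x y; rewrite /= /oplus_adj /image_adj /code_adj !nq // !gE !fadj.
split; first by rewrite size_mkseq.
  move=> z /mapP [i]; rewrite mem_iota /= => /fsN [x <-] ->; rewrite gE; exact: fin.
move=> i iN; have tks : size (take i (mkseq g N)) = i.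
  by rewrite size_takel // size_mkseq ltnW.
rewrite nq //= /code_ok tks.
have tk j : j < i -> nth 0 (take i (mkseq g N)) j = g j.
  by move=> ji; rewrite nth_take // nq // (ltn_trans ji).
have [x xi] := fsN i iN; rewrite lazy_allE ifN; last first.
  apply/negP=> /(nthP 0) [j]; rewrite tks => ji.
  have [y yj] := fsN j (ltn_trans ji iN).
  rewrite tk // -xi -yj !gE => /fi /perm_inj e; rewrite e xi in yj.
  by rewrite yj ltnn in ji.
apply/allP=> j; rewrite mem_iota /= => ji; rewrite tk //.
have [y yj] := fsN j (ltn_trans ji iN); rewrite -xi -yj !gE -!fadj.
by case: ifP => // h; apply/negP=> /emb; rewrite !permKV h.
Qed.

Lemma iso_code N (u v : rel nat) g : symmetric u -> symmetric v ->
  admissible (iota 0 N) (iso_ok u v) N [::] g ->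
  [/\ {in iota 0 N &, forall i j, v (nth 0 g i) (nth 0 g j) = u i j},
      {in iota 0 N &, injective (nth 0 g)} &
      {in iota 0 N, forall i, nth 0 g i \in iota 0 N}].
Proof.
move=> us vs [sg sub h].
have tk i : i < N -> size (take i g) = i by move=> iN; rewrite size_takel ?sg // ltnW.
have lt j i : j < i -> i < N -> u j i = v (nth 0 g j) (nth 0 g i) /\ nth 0 g j != nth 0 g i.
  move=> ji iN; have := h i iN; rewrite /iso_ok /= tk // lazy_allE.
  case: ifP => // /negbT ni; case: ifP => // _ /allP al.
  have := al j; rewrite mem_iota /= nth_take // => /(_ ji) /eqP; split=> //.
  by apply: contraNneq ni => <-; rewrite -(nth_take 0 ji) mem_nth ?tk.
split.
- move=> i j; rewrite !mem_iota /= => iN jN; case: (ltngtP i j) => [ij|ji|<-].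
  + by have [->] := lt _ _ ij jN.
  + by rewrite vs us; have [->] := lt _ _ ji iN.
  + by have := h i iN; rewrite /iso_ok /= tk //; case: ifP => // _; case: eqP.
- move=> i j; rewrite !mem_iota /= => iN jN e; case: (ltngtP i j) => [ij|ji|//].
  + by have [_] := lt _ _ ij jN; rewrite e eqxx.
  + by have [_] := lt _ _ ji iN; rewrite e eqxx.
by move=> i; rewrite mem_iota /= => iN; apply: sub; rewrite mem_nth ?sg.
Qed.

(** The search asserts that no isomorphism exists; its failure supplies one, with which the labels
    are composed. *)
Lemma labelling_recode (G : sgraph) N (u v : rel nat) f : symmetric u -> symmetric v ->
  @labelling G (iota 0 N) u f -> ~~ all_ext (iota 0 N) (iso_ok u v) (fun=> false) N [::] ->
  exists f', @labelling G (iota 0 N) v f'.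
Proof.
move=> us vs [fi fin fs fadj] /all_ext_false [g /(iso_code us vs) [ga gi gin] _].
exists (nth 0 g \o f); apply: labelling_card.
- by move=> x y /gi e; apply: fi; apply: e.
- by move=> x; exact: gin.
- rewrite size_iota -[N in N <= _](size_iota 0) cardE -(size_map f).
  apply: uniq_leq_size; first exact: iota_uniq.
  by move=> i /fs [x <-]; rewrite map_f ?mem_enum.
by move=> x y; rewrite fadj /= ga.
Qed.

(* Adjacency is tabulated because evaluating [ladj] inside the searches is too slow. *)
Definition table N (u : rel nat) := [seq [seq u i j | j <- iota 0 N] | i <- iota 0 N].
Definition lookup (M : seq (seq bool)) : rel nat :=
  fun i j => nth false (nth [::] M i) j.

Lemma lookup_table N u i j : lookup (table N u) i j = [&& i < N, j < N & u i j].
Proof.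
rewrite /lookup /table; have [iN|iN] := ltnP i N; last first.
  by rewrite [X in nth _ X j]nth_default ?nth_nil // size_map size_iota.
rewrite (nth_map 0) ?size_iota // nth_iota //.
have [jN|jN] := ltnP j N; last by rewrite nth_default // size_map size_iota.
by rewrite (nth_map 0) ?size_iota // nth_iota.
Qed.

Lemma lookup_table_sym N u : symmetric u -> symmetric (lookup (table N u)).
Proof. by move=> us i j; rewrite !lookup_table us andbCA. Qed.

Lemma labelling_table G N u f :
  @labelling G (iota 0 N) u f -> @labelling G (iota 0 N) (lookup (table N u)) f.
Proof.
move=> [fi fin fs fadj]; split=> // x y.
by have := fin x; have := fin y; rewrite lookup_table fadj !mem_iota /= => -> ->.
Qed.

Definition no_packing ns :=
  let N := sumn ns in let A := table N (ladj (blocks ns)) in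
  all_ext (iota 0 N) (code_ok (lookup A)) (fun=> false) N [::].

(** Each union is compared only with the one coded by [q0]; any two are then isomorphic through it.
    The negated inner search expresses that an isomorphism exists. *)
Definition unique_packing ns q0 :=
  let N := sumn ns in let A := table N (ladj (blocks ns)) in
  let B := table N (code_adj (lookup A) q0) in
  all_ext (iota 0 N) (code_ok (lookup A))
    (fun q => let C := table N (code_adj (lookup A) q) in
       ~~ all_ext (iota 0 N) (iso_ok (lookup C) (lookup B)) (fun=> false) N [::])
    N [::].

Lemma block_table_labelling G ns : isomorphic G (cycles ns) -> all (leq 3) ns ->
  exists f, @labelling G (iota 0 (sumn ns))
    (lookup (table (sumn ns) (ladj (blocks ns)))) f.
Proof.
move=> iso a3; have [f hf] := blocks_labelling iso a3 (perm_refl _).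
by exists f; apply: labelling_table; rewrite flatten_blocks in hf.
Qed.

Lemma no_packing_not_embeddable G ns : isomorphic G (cycles ns) -> all (leq 3) ns ->
  no_packing ns -> ~ embeddable G.
Proof.
move=> iso a3 no [s emb]; have [f hf] := block_table_labelling iso a3.
by have [q [aq _]] := embedding_code hf emb; have := all_ext_true no aq.
Qed.

Lemma code_adj_sym a q : symmetric a -> symmetric (code_adj a q).
Proof. by move=> as' i j; rewrite /code_adj as' (as' (nth 0 q i)). Qed.

Lemma unique_packing_iso G ns q0 : isomorphic G (cycles ns) -> all (leq 3) ns ->
  unique_packing ns q0 -> forall s1 s2 : {perm G}, embedding s1 -> embedding s2 ->
  isomorphic (oplus s1) (oplus s2).
Proof.
move=> iso a3; set N := sumn ns; set A := table N (ladj (blocks ns)).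
rewrite /unique_packing -/N -/A /= => un s1 s2 emb1 emb2.
have [f hf] := block_table_labelling iso a3.
have sym q : symmetric (lookup (table N (code_adj (lookup A) q))).
  by apply/lookup_table_sym/code_adj_sym/lookup_table_sym/ladj_sym.
have [q1 [/(all_ext_true un) a1 l1]] := embedding_code hf emb1.
have [q2 [/(all_ext_true un) a2 l2]] := embedding_code hf emb2.
have [f1 h1] := labelling_recode (sym q1) (sym q0) (labelling_table l1) a1.
have [f2 h2] := labelling_recode (sym q2) (sym q0) (labelling_table l2) a2.
exact: labelling_iso h1 h2.
Qed.

Lemma packs_embeddable G ns bs : isomorphic G (cycles ns) ->
  packs ns (blocks ns) bs -> embeddable G.
Proof. by move=> iso P; have [s [emb _]] := realize iso P; exists s. Qed.


Lemma isomorphic_sym G H : isomorphic G H -> isomorphic H G.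
Proof.
move=> [f [g fK gK] fadj]; exists g; first by exists f.
by move=> x y; rewrite -fadj !gK.
Qed.

Lemma unique_packing_embeddable G ns bs q0 : isomorphic G (cycles ns) ->
  packs ns (blocks ns) bs -> unique_packing ns q0 -> uniquely_embeddable G.
Proof.
move=> iso P un; split; first exact: packs_embeddable iso P.
by apply: (unique_packing_iso iso _ un); case/and5P: P.
Qed.

Theorem theorem5 :
  [/\ List.Forall (fun H : sgraph => ~ embeddable H) not_embeddable_list,
      List.Forall uniquely_embeddable uniquely_embeddable_list
    & forall G : sgraph,
        union_of_cycles G ->
        List.Forall (fun H : sgraph => ~ isomorphic G H)
          (not_embeddable_list ++ uniquely_embeddable_list) ->
        exists s1 s2 : {perm G}, distinct_embeddings s1 s2].
Proof.
have c1 n : isomorphic (cycle_graph n) (cycles [:: n]).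
  exact/isomorphic_sym/iso_cycles1.
have c2 m n : isomorphic (disjoint_union (cycle_graph m) (cycle_graph n)) (cycles [:: m; n]).
  exact/isomorphic_sym/iso_cycles2.
have c3 n : 2 < n ->
    isomorphic (disjoint_union (cycle_graph 3) (cycle_graph n)) (cycles [:: n; 3]).
  move=> n3; apply: (isomorphic_perm (c2 3 n)); first by rewrite /= n3.
  exact: (permEl (perm_catC [:: 3] [:: n])).
split; last exact: union_of_cycles_two.
- apply/List.Forall_cons; first by apply: no_packing_not_embeddable (c1 3) _ _; vm_compute.
  apply/List.Forall_cons; first by apply: no_packing_not_embeddable (c1 4) _ _; vm_compute.
  apply/List.Forall_cons; last exact: List.Forall_nil.
  by apply: (@no_packing_not_embeddable _ [:: 3; 3] (isomorphic_refl _)); vm_compute.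
apply/List.Forall_cons.
  (* Here and below [q0] concatenates the blue cycles: as a permutation it carries the red blocks
     onto them. *)
  by apply: (unique_packing_embeddable (bs := [:: [:: 0; 2; 4; 1; 3]])
    (q0 := [:: 0; 2; 4; 1; 3]) (c1 5)); vm_compute.
apply/List.Forall_cons.
  by apply: (unique_packing_embeddable (bs := [:: [:: 5; 2; 0; 4; 1; 3]])
    (q0 := [:: 5; 2; 0; 4; 1; 3]) (c1 6)); vm_compute.
apply/List.Forall_cons.
  apply: (unique_packing_embeddable
    (bs := [:: [:: 6; 1; 5; 3]; [:: 0; 4; 2]]) (q0 := [:: 6; 1; 5; 3; 0; 4; 2]) (c3 4 isT)).
    by vm_compute.
  by vm_compute.
apply/List.Forall_cons.
  apply: (unique_packing_embeddable
    (bs := [:: [:: 6; 1; 4; 5; 3]; [:: 0; 2; 7]]) (q0 := [:: 6; 1; 4; 5; 3; 0; 2; 7]) (c3 5 isT)).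
    by vm_compute.
  by vm_compute.
apply/List.Forall_cons.
  split.
    (* [copies 3 (cycle_graph 3)] is convertible to [cycles (nseq 3 3)], so reflexivity suffices.
       Uniqueness comes from the board instead of a search. *)
    apply: (@packs_embeddable _ (nseq 3 3) [:: [:: 2; 4; 8]; [:: 0; 7; 5]; [:: 1; 6; 3]] (isomorphic_refl _)).
    by vm_compute.
  move=> s1 s2 /three_triangles_labelling [f1 h1] /three_triangles_labelling [f2 h2].
  exact: labelling_iso h1 h2.
apply/List.Forall_cons; last exact: List.Forall_nil.
split.
  apply: (@packs_embeddable _ (nseq 4 3) [:: [:: 2; 5; 8]; [:: 10; 7; 4]; [:: 9; 3; 0]; [:: 11; 6; 1]] (isomorphic_refl _)).
  by vm_compute.
move=> s1 s2 /four_triangles_labelling [f1 h1] /four_triangles_labelling [f2 h2].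
exact: labelling_iso h1 h2.
Qed.
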